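(* Let $K$ be a number field of degree $n=[K:\mathbb Q]$ with ring of integers $\mathscr O$, let $\theta$ be a field automorphism of $K$ with $\theta^2=\mathrm{id}$, let $\mathrm{tr}_{K,\theta}(x,y):=\mathrm{Trace}_{K/\mathbb Q}(x\theta(y))$, and let $m$ be the positive integer with $\mathrm{Trace}_{K/\mathbb Q}(\mathscr O)=m\mathbb Z$. The following are equivalent: (a) $(\mathscr O,\mathrm{tr}_{K,\theta})$ is similar to $\mathbb Z^n$; (b) $(\mathscr O,\mathrm{tr}_{K,\theta})$ is similar to $\mathbb A_1^n$; (c) $(\mathscr O,\mathrm{tr}_{K,\theta}/m)$ is isometric to $\mathbb Z^n$; (d) $(\mathscr O,2\,\mathrm{tr}_{K,\theta}/m)$ is isometric to $\mathbb A_1^n$; (e) $K$ is a $2^a$th cyclotomic field for some positive integer $a$, and $\theta$ is complex conjugation if $a>1$ and $\theta=\mathrm{id}$ if $a=1$. If these hold, then $n=2^{a-1}$ and $m=n$. Moreover, in (e), if $\zeta_{2^a}\in K$ is a primitive $2^a$th root of unity and $x_j:=\zeta_{2^a}^j$, then the indecomposable components of the root lattice $(\mathscr O,\mathrm{tr}_{K,\theta}/m)$ are exactly the sublattices $\mathbb Zx_j$, $0\le j\le 2^{a-1}-1$, and $\mathrm{tr}_{K,\theta}(x_j,x_j)/m=1$ for every $j$.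
   Context: A lattice is a pair $(L,b)$, $L$ a free $\mathbb Z$-module of finite rank, $b$ a nondegenerate symmetric $\mathbb Z$-valued bilinear form. Lattices $(L_1,b_1),(L_2,b_2)$ are similar if there are nonzero integers $m_1,m_2$ with $(L_1,m_1b_1)$ isometric to $(L_2,m_2b_2)$. $\mathbb Z^n$ is $\mathbb Z^n\subset\mathbb R^n$ with the standard dot product; $\mathbb A_1=\{(x_1,x_2)\in\mathbb Z^2: x_1+x_2=0\}$ with the dot product (a rank-one lattice with generator of square norm $2$); $(L,b)^s$ denotes the orthogonal direct sum of $s$ copies. A lattice is indecomposable if it is not an orthogonal direct sum of two nonzero sublattices; the indecomposable components of a root lattice are the summands of its (unique) decomposition into indecomposable orthogonal summands. *)

(* Defs.v *)
From HB Require Import structures.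
From mathcomp Require Import all_boot all_order all_algebra all_field.
From mathcomp Require Import boolp classical_sets.

Set Implicit Arguments.
Unset Strict Implicit.
Unset Printing Implicit Defensive.

Import Order.TTheory GRing.Theory Num.Theory passmx.
Local Open Scope classical_set_scope.
Local Open Scope ring_scope.

(* Forms take values in rat, so that tr / m can be written literally; that
   they are integer-valued is part of is_lattice. *)
Record bilinear_module := BilinearModule {
  bm_sort :> zmodType;
  bform : bm_sort -> bm_sort -> rat
}.

Definition free_of_finite_rank (V : zmodType) : Prop :=
  exists (r : nat) (e : 'I_r -> V),
    forall x : V, exists! a : {ffun 'I_r -> int}, x = \sum_i e i *~ a i.

Record is_lattice (L : bilinear_module) : Prop := IsLattice {
  lattice_free : free_of_finite_rank L;
  lattice_addl : forall x y z : L, bform (x + y) z = bform x z + bform y z;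
  lattice_sym : forall x y : L, bform x y = bform y x;
  lattice_int : forall x y : L, bform x y \is a Num.int;
  lattice_nondeg : forall x : L, (forall y : L, bform x y = 0) -> x = 0
}.

Record lattice := Lattice {
  lattice_module :> bilinear_module;
  latticeP : is_lattice lattice_module
}.

Definition scale (c : rat) (L : bilinear_module) : bilinear_module :=
  @BilinearModule L (fun x y => c * bform x y).

Definition isometric (L1 L2 : bilinear_module) : Prop :=
  exists2 f : {additive L1 -> L2},
    bijective f & forall x y : L1, bform (f x) (f y) = bform x y.

Definition similar_lattices (L1 L2 : lattice) : Prop :=
  exists m1 m2 : int,
    [/\ m1 != 0, m2 != 0 & isometric (scale m1%:~R L1) (scale m2%:~R L2)].

Definition intlat_mod (n : nat) : bilinear_module :=
  @BilinearModule 'rV[int]_n (fun x y => (\sum_i x 0 i * y 0 i)%:~R).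

Definition A1_pred : {pred 'rV[int]_2} := [pred x : 'rV[int]_2 | \sum_i x 0 i == 0].

Fact A1_closed : zmod_closed A1_pred.
Proof.
split=> [|x y]; rewrite !inE; first by rewrite big1 // => i _; rewrite mxE.
move=> /eqP hx /eqP hy; apply/eqP.
under eq_bigr do rewrite !mxE.
by rewrite sumrB hx hy subr0.
Qed.

HB.instance Definition _ := GRing.isZmodClosed.Build _ A1_pred A1_closed.

Record A1_type := A1Type { A1_val :> 'rV[int]_2; _ : A1_val \in A1_pred }.
HB.instance Definition _ := [isSub for A1_val].
HB.instance Definition _ := [Choice of A1_type by <:].
HB.instance Definition _ := [SubChoice_isSubZmodule of A1_type by <:].

Definition A1_mod : bilinear_module :=
  @BilinearModule A1_type (fun x y => (\sum_i (val x) 0 i * (val y) 0 i)%:~R).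

(* The orthogonal direct sum of s copies of L. *)
Definition pow_mod (L : bilinear_module) (s : nat) : bilinear_module :=
  @BilinearModule {ffun 'I_s -> L} (fun x y => \sum_i bform (x i) (y i)).

Definition integral_pred (K : fieldExtType rat) : {pred K} :=
  fun x => `[< integralOver (intr : int -> K) x >].
Arguments integral_pred K : clear implicits.

Fact integral_closed (K : fieldExtType rat) : subring_closed (integral_pred K).
Proof.
split=> [|x y|x y]; first exact/asboolP/integral1.
- by move=> /asboolP hx /asboolP hy; apply/asboolP/integral_sub.
- by move=> /asboolP hx /asboolP hy; apply/asboolP/integral_mul.
Qed.

HB.instance Definition _ (K : fieldExtType rat) :=
  GRing.isSubringClosed.Build _ (integral_pred K) (@integral_closed K).

Record ring_of_integers (K : fieldExtType rat) := RingOfIntegers {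
  integer_val :> K;
  _ : integer_val \in integral_pred K
}.
HB.instance Definition _ (K : fieldExtType rat) := [isSub for @integer_val K].
HB.instance Definition _ (K : fieldExtType rat) :=
  [Choice of ring_of_integers K by <:].
HB.instance Definition _ (K : fieldExtType rat) :=
  [SubChoice_isSubComNzRing of ring_of_integers K by <:].

Definition field_trace (K : fieldExtType rat) (x : K) : rat :=
  \tr (mxof (vbasis {:K}) (vbasis {:K}) (amulr x)).

Definition trace_form (K : fieldExtType rat) (theta : {rmorphism K -> K})
    (x y : K) : rat :=
  field_trace (x * theta y).

Definition trace_ideal_generator (K : fieldExtType rat) (m : nat) : Prop :=
  [set field_trace (val x) | x in [set: ring_of_integers K]] =
  [set m%:R * k%:~R | k in [set: int]].

Definition trace_mod (K : fieldExtType rat) (theta : {rmorphism K -> K}) :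
    bilinear_module :=
  @BilinearModule (ring_of_integers K)
    (fun x y => trace_form theta (val x) (val y)).

Section Freeness.
Variables (V : zmodType).

Lemma subgroup_basis (n : nat) (c : nat -> {additive V -> int}) (P : set V) :
  P 0 -> (forall x y, P x -> P y -> P (x - y)) ->
  (forall x, P x -> (forall i, (i < n)%N -> c i x = 0) -> x = 0) ->
  exists (r : nat) (e : 'I_r -> V), (forall i, P (e i)) /\
    forall x, P x -> exists! a : {ffun 'I_r -> int}, x = \sum_i e i *~ a i.
Proof.
elim: n P => [|n IHn] P P0 PB Pc.
  exists 0%N, (fun=> 0); split=> [[]//|x Px].
  exists [ffun=> 0]; split; first by rewrite big_ord0; apply: Pc.
  by move=> a _; apply/ffunP=> -[].
have PN x : P x -> P (- x) by move=> Px; rewrite -sub0r; apply: PB.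
have PD x y : P x -> P y -> P (x + y).
  by move=> Px Py; rewrite -[y]opprK; apply: PB => //; apply: PN.
have PZ x k : P x -> P (x *~ k).
  move=> Px; case: k => k; last rewrite NegzE mulrNz.
    by rewrite -pmulrn; elim: k => [|k IHk]; rewrite ?mulr0n // mulrS; apply: PD.
  by apply: PN; rewrite -pmulrn; elim: k => [|k IHk] //; rewrite mulrS; apply: PD.
pose P' := [set x | P x /\ c n x = 0].
have P'P x : P' x -> P x by case.
have [r [e [Pe he]]] : exists (r : nat) (e : 'I_r -> V), (forall i, P' (e i)) /\
    forall x, P' x -> exists! a : {ffun 'I_r -> int}, x = \sum_i e i *~ a i.
  apply: IHn => [|x y [Px cx] [Py cy]|x [Px cx] hx].
  - by split; rewrite ?raddf0.
  - by split; [apply: PB | rewrite raddfB /= cx cy subrr].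
  - apply: Pc => // i; rewrite ltnS leq_eqVlt => /orP[/eqP->//|].
    exact: hx.
have [cP0|] := pselect (forall x, P x -> c n x = 0).
  by exists r, e; split=> [i|x Px]; [apply: P'P | apply: he; split=> //; apply: cP0].
move/existsNP=> [x0 /not_implyP[Px0 /eqP cx0]].
have exd : exists d : nat, (0 < d)%N && `[< exists2 v, P v & c n v = d >].
  exists `|c n x0|%N; rewrite absz_gt0 cx0 /=; apply/asboolP.
  have [ge0|lt0] := leP 0 (c n x0); first by exists x0; rewrite ?gez0_abs.
  by exists (- x0); [apply: PN | rewrite raddfN ltz0_abs].
case: (ex_minnP exd) => d /andP[d_gt0 /asboolP[v Pv cv]] dmin.
have dn0 : d%:Z != 0 by rewrite eqz_nat -lt0n.
have divd x : P x -> c n x = d%:Z * (c n x %/ d%:Z)%Z.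
  move=> Px; set q := (_ %/ _)%Z; rewrite [LHS](divz_eq _ d%:Z) -/q mulrC.
  set s := (_ %% _)%Z; have s_ge0 : 0 <= s by rewrite modz_ge0.
  suff -> : s = 0 by rewrite addr0.
  have s_lt : s < d by rewrite ltz_pmod.
  apply/eqP; apply: contraTT s_lt => s_neq0; rewrite -leNgt -(gez0_abs s_ge0) lez_nat.
  apply: dmin; rewrite absz_gt0 s_neq0 /=; apply/asboolP.
  exists (x - v *~ q); first by apply: PB => //; apply: PZ.
  by rewrite raddfB /= raddfMz /= cv gez0_abs // /s /modz mulrzz [_ * q]mulrC.
pose e' := fun i : 'I_r.+1 => if unlift ord0 i is Some j then e j else v.
have sume' (a : {ffun 'I_r.+1 -> int}) :
    \sum_i e' i *~ a i = v *~ a ord0 + \sum_i e i *~ a (lift ord0 i).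
  rewrite big_ord_recl /e' unlift_none; congr (_ + _).
  by apply: eq_bigr => i _; rewrite liftK.
have csum (b : 'I_r -> int) : c n (\sum_i e i *~ b i) = 0.
  rewrite raddf_sum big1 // => i _.
  by have [_ ci] := Pe i; rewrite raddfMz /= ci mul0rz.
exists r.+1, e'; split=> [i|x Px].
  by rewrite /e'; case: unliftP => [j|] _ //; apply: P'P.
pose q := (c n x %/ d%:Z)%Z.
have [|a [xa aU]] := he (x - v *~ q).
  split; first by apply: PB => //; apply: PZ.
  by rewrite raddfB /= raddfMz /= cv {1}(divd _ Px) -mulrzz subrr.
exists [ffun i => if unlift ord0 i is Some j then a j else q]; split.
  rewrite sume' ffunE unlift_none; under eq_bigr do rewrite ffunE liftK.
  by rewrite -xa addrC subrK.
move=> b; rewrite sume' => xb.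
have b0 : b ord0 = q.
  have := congr1 (c n) xb; rewrite raddfD /= csum addr0 raddfMz /= cv.
  by rewrite {1}(divd _ Px) mulrzz => /(mulfI dn0).
have ab : a = [ffun i => b (lift ord0 i)].
  apply: aU; rewrite xb b0 addrAC subrr add0r.
  by apply: eq_bigr => i _; rewrite ffunE.
apply/ffunP=> i; rewrite ffunE; case: unliftP => [j ->|->]; last by rewrite b0.
by rewrite ab ffunE.
Qed.

Lemma free_of_separating (I : finType) (c : I -> V -> int) :
  (forall i, zmod_morphism (c i)) ->
  (forall x, (forall i, c i x = 0) -> x = 0) ->
  free_of_finite_rank V.
Proof.
move=> cB hc.
pose cA i : {additive V -> int} :=
  HB.pack (c i) (GRing.isZmodMorphism.Build V int (c i) (cB i)).
pose c' k : {additive V -> int} :=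
  if insub k : option 'I_#|I| is Some j then cA (enum_val j) else \0.
have [|||r [e [_ he]]] := @subgroup_basis #|I| c' setT.
- by [].
- by [].
- move=> x _ hx; apply: hc => i.
  by have := hx (enum_rank i) (ltn_ord _); rewrite /c' valK /= enum_rankK.
by exists r, e => x; apply: he.
Qed.

Lemma separating_of_free : free_of_finite_rank V ->
  exists (r : nat) (c : 'I_r -> V -> int),
    (forall i, zmod_morphism (c i)) /\
    (forall x, (forall i, c i x = 0) -> x = 0).
Proof.
move=> [r [e he]]; pose a x := projT1 (cid (he x)).
have aE x : x = \sum_i e i *~ a x i by rewrite /a; case: cid => ? [].
have aU x (b : {ffun 'I_r -> int}) : x = \sum_i e i *~ b i -> a x = b.
  by rewrite /a; case: cid => ? [? h] /h.
exists r, (fun i x => a x i); split=> [i x y|x hx].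
  have -> : a (x - y) = [ffun i => a x i - a y i].
    apply: aU; rewrite {1}(aE x) {1}(aE y) -sumrB.
    by apply: eq_bigr => j _; rewrite ffunE mulrzBr.
  by rewrite ffunE.
by rewrite (aE x) big1 // => i _; rewrite hx mulr0z.
Qed.
End Freeness.

Section Trace.
Variable K : fieldExtType rat.
Let b := vbasis {:K}.
Let bb : basis_of {:K} b := vbasisP _.

Lemma field_traceD (x y : K) : field_trace (x + y) = field_trace x + field_trace y.
Proof. by rewrite /field_trace !linearD. Qed.

Lemma field_traceZ (a : rat) (x : K) : field_trace (a *: x) = a * field_trace x.
Proof. by rewrite /field_trace !linearZ. Qed.

Lemma field_traceB (x y : K) : field_trace (x - y) = field_trace x - field_trace y.
Proof. by rewrite /field_trace !linearB. Qed.

Lemma field_trace_sum (I : finType) (f : I -> K) :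
  field_trace (\sum_i f i) = \sum_i field_trace (f i).
Proof. by rewrite /field_trace !linear_sum. Qed.

Lemma field_trace1 : field_trace (1 : K) = (\dim {:K})%:R.
Proof.
rewrite /field_trace -(@mxtrace_scalar _ (\dim {:K})) -(mxof1 (basis_free bb)).
by congr (\tr (mxof _ _ _)); apply/lfunP=> y; rewrite lfunE /= mulr1 id_lfunE.
Qed.

Lemma mxof_amulrM (x y : K) :
  mxof b b (amulr (x * y)) = mxof b b (amulr x) *m mxof b b (amulr y).
Proof.
rewrite -mxof_comp //; congr mxof.
by apply/lfunP=> z; rewrite comp_lfunE !lfunE /= mulrA.
Qed.

Lemma field_trace_int (x : K) :
  x \in integral_pred K -> field_trace x \is a Num.int.
Proof.
move=> /asboolP[p mon_p /rootP px0].
set M := mxof b b (amulr x); set MC : 'M[algC]_(\dim {:K}) := map_mx ratr M.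
have powM i (v : 'rV[algC]_(\dim {:K})) a : v *m MC = a *: v ->
    v *m map_mx ratr (mxof b b (amulr (x ^+ i))) = a ^+ i *: v.
  move=> hv; elim: i => [|i IHi].
    have -> : amulr (x ^+ 0) = \1%VF.
      by apply/lfunP=> y; rewrite lfunE /= mulr1 id_lfunE.
    by rewrite mxof1 ?(basis_free bb) // map_mx1 mulmx1 scale1r.
  by rewrite exprSr mxof_amulrM map_mxM mulmxA IHi -scalemxAl hv scalerA -exprSr.
have eigA a : root (char_poly MC) a -> a \in Aint.
  rewrite -eigenvalue_root_char => /eigenvalueP[v hv v_neq0].
  apply: (@root_monic_Aint (map_poly intr p)); last 2 first.
  - by rewrite monic_map.
  - by apply/polyOverP=> i; rewrite coef_map /= rpred_int.
  have : v *m map_mx ratr (mxof b b (amulr (map_poly intr p).[x])) = 0.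
    by rewrite px0 !linear0 map_mx0 mulmx0.
  rewrite horner_coef !linear_sum /= map_mx_sum mulmx_sumr => /eqP.
  have -> : \sum_(i < size (map_poly (intr : int -> K) p)) v *m
        map_mx ratr (mxof b b (amulr ((map_poly intr p)`_i * x ^+ i))) =
      (map_poly intr p).[a] *: v; last first.
    by rewrite scaler_eq0 (negPf v_neq0) orbF.
  rewrite horner_coef scaler_suml.
  rewrite !size_map_poly_id0 ?(monicP mon_p) ?rmorph1 ?oner_eq0 //.
  apply: eq_bigr => i _; rewrite !coef_map /= mulrzl !raddfMz /=.
  rewrite (powM _ _ _ hv) mulrzl.
  by rewrite scalerMzl.
have [r def_char] := closed_field_poly_normal (char_poly MC).
rewrite (monicP (char_poly_monic _)) scale1r in def_char.
have rA : {subset r <= Aint}.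
  by move=> a ra; apply: eigA; rewrite def_char root_prod_XsubC.
have size_r : size r = \dim {:K}.
  by apply: succn_inj; rewrite -(size_char_poly MC) def_char size_prod_XsubC.
have trr : \tr MC = \sum_(a <- r) a.
  apply: oppr_inj; rewrite -char_poly_trace ?adim_gt0 //.
  by rewrite def_char -size_r coefPn_prod_XsubC // size_r -lt0n adim_gt0.
rewrite -[_ \is a _]Cint_rat; apply: Cint_rat_Aint; first exact: Crat_rat.
by rewrite -trace_map_mx -/MC trr big_seq; apply: rpred_sum => a /rA.
Qed.

Lemma clear_denominator (x : K) :
  exists2 l : int, l != 0 & x *~ l \in integral_pred K.
Proof.
have /polyOver1P[q Dq] := minPolyOver 1 x.
have [P [a a_neq0 DP]] := rat_poly_scale q.
have q_neq0 : q != 0.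
  apply: contraTneq (monic_minPoly 1 x) => q0.
  by rewrite Dq q0 rmorph0 monicE lead_coef0 eq_sym oner_eq0.
have P_neq0 : P != 0 by apply: contraNneq q_neq0 => P0; rewrite DP P0 rmorph0 scaler0.
have Px0 : (map_poly intr P : {poly K}).[x] = 0.
  have := root_minPoly 1 x; rewrite Dq DP map_polyZ rootZ; last first.
    by rewrite fmorph_eq0 invr_eq0 intr_eq0.
  rewrite -map_poly_comp => /rootP h; rewrite -[RHS]h; congr (_.[x]).
  by apply: eq_map_poly => k /=; rewrite -[LHS](rmorph_int (in_alg K)).
set l := lead_coef P; have l_neq0 : l != 0 by rewrite lead_coef_eq0.
exists l => //; apply/asboolP.
have [d sP] : exists d, size P = d.+1.
  by exists (size P).-1; rewrite prednK // lt0n size_poly_eq0.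
pose Q : {poly int} := 'X^(d.+1) + \poly_(i < d.+1) ((P * 'X)`_i * l ^+ (d - i)).
exists Q.
  by rewrite monicE lead_coefDl ?lead_coefXn // size_polyXn ltnS size_poly.
have Rx0 : \sum_(i < d.+2) ((P * 'X)`_i)%:~R * x ^+ i = 0.
  have : (map_poly intr (P * 'X) : {poly K}).[x] = 0.
    by rewrite rmorphM hornerM Px0 mul0r.
  rewrite (@horner_coef_wide _ d.+2); last first.
    by rewrite (leq_trans (size_poly _ _)) // size_mulX ?sP.
  by under eq_bigr do rewrite coef_map /=.
apply/rootP; rewrite rmorphD /= map_polyXn hornerD hornerXn.
rewrite (@horner_coef_wide _ d.+1); last first.
  by rewrite (leq_trans (size_poly _ _)) // size_poly.
transitivity (l%:~R ^+ d * \sum_(i < d.+2) ((P * 'X)`_i)%:~R * x ^+ i);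
  last by rewrite Rx0 mulr0.
rewrite [in RHS]big_ord_recr mulrDr addrC; congr (_ + _).
  rewrite mulr_sumr; apply: eq_bigr => i _ /=.
  rewrite coef_map coef_poly ltn_ord /= -[x *~ l]mulrzl exprMn rmorphM rmorphXn /=.
  have le_id : (i <= d)%N by rewrite -ltnS.
  have -> : (l%:~R : K) ^+ d = l%:~R ^+ (d - i) * l%:~R ^+ i.
    by rewrite -exprD subnK.
  rewrite [RHS]mulrACA; congr (_ * _).
  exact: mulrC.
have Pd : P`_d = l by rewrite /l lead_coefE sP.
by rewrite -[x *~ l]mulrzl exprMn coefMX /= Pd [l%:~R ^+ d.+1]exprSr -mulrA.
Qed.
Lemma field_trace_nondeg (x : K) : (forall y, field_trace (x * y) = 0) -> x = 0.
Proof.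
move=> hx; apply/eqP; apply: contraT => x_neq0.
have := hx x^-1; rewrite divff // field_trace1 => /eqP.
by rewrite pnatr_eq0 -leqn0 leqNgt adim_gt0.
Qed.

Lemma ring_of_integers_free : free_of_finite_rank (ring_of_integers K).
Proof.
have /choice[l hl] (i : 'I_(\dim {:K})) :
    exists l : int, l != 0 /\ b`_i *~ l \in integral_pred K.
  by have [l] := clear_denominator b`_i; exists l.
have cint (x : ring_of_integers K) (i : 'I_(\dim {:K})) :
    field_trace (val x * (b`_i *~ l i)) \is a Num.int.
  by apply/field_trace_int/rpredM; [apply: valP | apply: (hl i).2].
pose c (i : 'I_(\dim {:K})) (x : ring_of_integers K) :=
  numq (field_trace (val x * (b`_i *~ l i))).
apply: (@free_of_separating _ _ c) => [i x y|x hx].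
  apply: (@intr_inj rat); rewrite rmorphB /= !numqK ?cint //.
  by rewrite mulrBl field_traceB.
apply/val_inj/field_trace_nondeg => y.
rewrite (coord_basis bb (memvf y)) mulr_sumr field_trace_sum big1 // => i _.
rewrite -scalerAr field_traceZ.
have : field_trace (val x * (b`_i *~ l i)) = 0.
  by rewrite -[LHS]numqK ?cint //; have := hx i; rewrite /c => ->.
rewrite mulrzAr -scaler_int field_traceZ => /eqP.
by rewrite mulf_eq0 intr_eq0 (negPf (hl i).1) => /eqP->; rewrite mulr0.
Qed.

Variables (theta : {rmorphism K -> K}).

Lemma theta_scalable (a : rat) (x : K) : theta (a *: x) = a *: theta x.
Proof.
rewrite -mulr_algl rmorphM -[RHS]mulr_algl; congr (_ * _).
have := fmorph_eq_rat (theta \o in_alg K) a.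
by rewrite -(fmorph_eq_rat (in_alg K)).
Qed.

Lemma integral_theta (x : K) :
  x \in integral_pred K -> theta x \in integral_pred K.
Proof.
move=> /asboolP[p mon_p px0]; apply/asboolP; exists p => //.
rewrite -(fmorph_root theta) -map_poly_comp in px0.
by rewrite (eq_map_poly (g := theta \o intr)) // => k /=; rewrite rmorph_int.
Qed.

Hypothesis thetaK : forall x, theta (theta x) = x.

Lemma field_trace_theta (x : K) : field_trace (theta x) = field_trace x.
Proof.
pose T : 'End(K) := linfun theta.
have TE y : T y = theta y.
  have thetaP : linear theta by move=> a u v; rewrite rmorphD /= theta_scalable.
  pose thetaL : {linear K -> K} := HB.pack (theta : K -> K)
    (GRing.isLinear.Build rat K K *:%R theta thetaP).
  exact: (lfunE thetaL).
have TT : mxof b b T *m mxof b b T = 1%:M.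
  rewrite -mxof_comp // -(mxof1 (basis_free bb)); congr mxof.
  by apply/lfunP=> y; rewrite comp_lfunE !TE thetaK id_lfunE.
have TM : mxof b b T *m mxof b b (amulr (theta x)) = mxof b b (amulr x) *m mxof b b T.
  rewrite -!mxof_comp //; congr mxof.
  by apply/lfunP=> y; rewrite !comp_lfunE !TE !lfunE /= rmorphM.
rewrite /field_trace -/b -[mxof b b (amulr (theta x))]mul1mx -TT -mulmxA TM.
by rewrite mulmxA mxtrace_mulC mulmxA TT mul1mx.
Qed.

Lemma trace_mod_lattice : is_lattice (trace_mod theta).
Proof.
split=> /= [|x y z|x y|x y|x hx]; rewrite /trace_form.
- exact: ring_of_integers_free.
- by rewrite mulrDl field_traceD.
- by rewrite -field_trace_theta rmorphM thetaK mulrC.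
- by apply: field_trace_int; rewrite rpredM ?integral_theta ?(valP x) ?(valP y).
apply/val_inj/field_trace_nondeg => y.
have [l l_neq0 ly] := clear_denominator (theta y).
have := hx (RingOfIntegers ly); rewrite /trace_form /= raddfMz /= thetaK.
rewrite mulrzAr -scaler_int field_traceZ => /eqP.
by rewrite mulf_eq0 intr_eq0 (negPf l_neq0) => /eqP.
Qed.

End Trace.

Lemma scale_lattice (c : rat) (L : bilinear_module) : c != 0 ->
  (forall x y : L, c * bform x y \is a Num.int) ->
  is_lattice L -> is_lattice (scale c L).
Proof.
move=> c0 cint [Lfree LD LC Lint Lnd]; split=> //= [x y z|x y|x hx].
- by rewrite LD mulrDr.
- by rewrite LC.
- by apply: Lnd => y; apply: (mulfI c0); rewrite mulr0; apply: hx.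
Qed.

Lemma trace_div_mod_lattice (K : fieldExtType rat) (theta : {rmorphism K -> K})
    (thetaK : forall x, theta (theta x) = x) (m : nat) :
  (0 < m)%N -> trace_ideal_generator K m ->
  is_lattice (scale m%:R^-1 (trace_mod theta)).
Proof.
move=> m_gt0 hm; have m0 : (m%:R : rat) != 0 by rewrite pnatr_eq0 -lt0n.
apply: scale_lattice; [by rewrite invr_eq0| |exact: trace_mod_lattice].
move=> x y /=; rewrite /trace_form.
have xy : val x * theta (val y) \in integral_pred K.
  by rewrite rpredM ?integral_theta ?(valP x) ?(valP y).
have : [set field_trace (val x) | x in [set: ring_of_integers K]]
    (field_trace (val x * theta (val y))).
  by exists (RingOfIntegers xy).
by rewrite hm => -[k _ <-]; rewrite mulKf // intr_int.
Qed.

Lemma intlat_lattice (n : nat) : is_lattice (intlat_mod n).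
Proof.
split=> /= [|x y z|x y|x y|x /(_ x)/eqP].
- apply: (@free_of_separating _ _ (fun i (x : 'rV[int]_n) => x 0 i)).
    by move=> i x y; rewrite !mxE.
  by move=> x hx; apply/rowP=> i; rewrite hx mxE.
- rewrite -rmorphD -big_split /=; congr (_%:~R).
  by apply: eq_bigr => i _; rewrite mxE mulrDl.
- by congr (_%:~R); apply: eq_bigr => i _; rewrite mulrC.
- exact: intr_int.
rewrite intr_eq0 psumr_eq0 => [|i _]; last by rewrite -expr2 sqr_ge0.
move=> /allP h; apply/rowP=> i; rewrite mxE.
by have := h i (mem_index_enum _); rewrite mulf_eq0 orbb => /eqP.
Qed.

Lemma A1_lattice : is_lattice A1_mod.
Proof.
split=> /= [|x y z|x y|x y|x /(_ x)/eqP].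
- apply: (@free_of_separating _ _ (fun i (x : A1_type) => val x 0 i)).
    by move=> i x y; rewrite !mxE.
  by move=> x hx; apply/val_inj/rowP=> i; rewrite hx mxE.
- rewrite -rmorphD -big_split /=; congr (_%:~R).
  by apply: eq_bigr => i _; rewrite mxE mulrDl.
- by congr (_%:~R); apply: eq_bigr => i _; rewrite mulrC.
- exact: intr_int.
rewrite intr_eq0 psumr_eq0 => [|i _]; last by rewrite -expr2 sqr_ge0.
move=> /allP h; apply/val_inj/rowP=> i; rewrite mxE.
by have := h i (mem_index_enum _); rewrite mulf_eq0 orbb => /eqP.
Qed.

Lemma pow_lattice (L : bilinear_module) (s : nat) :
  is_lattice L -> is_lattice (pow_mod L s).
Proof.
move=> [/separating_of_free[r [c [cB hc]]] LD LC Lint Lnd].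
have L0 (z : L) : bform 0 z = 0.
  by apply: (addrI (bform 0 z)); rewrite -LD !addr0.
split=> /= [|x y z|x y|x y|x hx].
- apply: (@free_of_separating _ _
    (fun (ij : 'I_s * 'I_r) (x : {ffun 'I_s -> L}) => c ij.2 (x ij.1))).
    by move=> i x y; rewrite !ffunE cB.
  by move=> x hx; apply/ffunP=> i; rewrite ffunE; apply: hc => j; apply: (hx (i, j)).
- by rewrite -big_split; apply: eq_bigr => i _; rewrite ffunE LD.
- by apply: eq_bigr => i _; rewrite LC.
- by apply: rpred_sum.
apply/ffunP=> i; rewrite ffunE; apply: Lnd => z.
rewrite -[RHS](hx [ffun j => if j == i then z else 0]) (bigD1 i) //=.
rewrite ffunE eqxx big1 ?addr0 // => j /negPf ne_ji.
by rewrite ffunE ne_ji LC L0.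
Qed.

Definition int_lattice (n : nat) : lattice := Lattice (intlat_lattice n).

Definition A1 : lattice := Lattice A1_lattice.

Definition lattice_pow (L : lattice) (s : nat) : lattice :=
  Lattice (pow_lattice s (latticeP L)).

Definition trace_lattice (K : fieldExtType rat) (theta : {rmorphism K -> K})
    (thetaK : forall x, theta (theta x) = x) : lattice :=
  Lattice (trace_mod_lattice thetaK).

Definition trace_div_lattice (K : fieldExtType rat)
    (theta : {rmorphism K -> K}) (thetaK : forall x, theta (theta x) = x)
    (m : nat) (m_gt0 : (0 < m)%N) (trm : trace_ideal_generator K m) : lattice :=
  Lattice (trace_div_mod_lattice thetaK m_gt0 trm).

Definition is_sublattice (L : lattice) (M : set L) : Prop :=
  M 0 /\ forall x y : L, M x -> M y -> M (x - y).

Definition orthogonal_sublattices (L : lattice) (M N : set L) : Prop :=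
  forall x y : L, M x -> N y -> bform x y = 0.

Definition orthogonal_direct_sum (L : lattice) (N : set L)
    (k : nat) (M : 'I_k -> set L) : Prop :=
  [/\ forall i, is_sublattice (M i) /\ M i `<=` N,
      forall i j, i != j -> orthogonal_sublattices (M i) (M j)
    & forall x : L, N x ->
        exists! y : {ffun 'I_k -> L}, (forall i, M i (y i)) /\ x = \sum_i y i].

Definition indecomposable (L : lattice) (N : set L) : Prop :=
  ~ exists M : 'I_2 -> set L,
      orthogonal_direct_sum N M /\ forall i, M i != [set 0].

Definition indecomposable_decomposition (L : lattice)
    (k : nat) (M : 'I_k -> set L) : Prop :=
  orthogonal_direct_sum [set: L] M /\
  forall i, M i != [set 0] /\ indecomposable (M i).

Definition indecomposable_components (L : lattice)
    (k : nat) (M : 'I_k -> set L) : Prop :=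
  indecomposable_decomposition M /\
  forall (k' : nat) (M' : 'I_k' -> set L), indecomposable_decomposition M' ->
    exists2 s : 'I_k' -> 'I_k, bijective s & forall i, M' i = M (s i).

(* Roots are the vectors of square norm 1 or 2, so that Z^n is a root
   lattice. *)
Definition root_lattice (L : lattice) : Prop :=
  (forall x : L, x != 0 -> 0 < bform x x) /\
  forall M : set L, is_sublattice M ->
    (forall x : L, bform x x = 1 \/ bform x x = 2 -> M x) -> M = [set: L].

Definition int_span (K : fieldExtType rat) (x : K) : set (ring_of_integers K) :=
  [set y | exists k : int, val y = x *~ k].

Definition cyclotomic_field (K : fieldExtType rat) (N : nat) : Prop :=
  exists2 z : K, N.-primitive_root z & <<1; z>>%VS = {:K}%VS.

(* K is abstract, so complex conjugation is the map which every complex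
   embedding of K carries to conjugation; all such embeddings land in algC. *)
Definition complex_conjugation (K : fieldExtType rat)
    (theta : {rmorphism K -> K}) : Prop :=
  forall (sigma : {rmorphism K -> algC}) (x : K),
    sigma (theta x) = (sigma x)^*.

Definition two_power_cyclotomic (K : fieldExtType rat)
    (theta : {rmorphism K -> K}) (a : nat) : Prop :=
  [/\ (0 < a)%N, cyclotomic_field K (2 ^ a),
      (1 < a)%N -> complex_conjugation theta
    & a = 1%N -> forall x, theta x = x].

(* Main.v *)
(* Let L be (O, tr/m). In an orthonormal basis e_1, ..., e_n of L, the trace of
   multiplication by x theta(x) is the sum of the squared norms q(x e_i), and
   each of these is a positive integer when x <> 0. Hence
   m q(x) = tr(x theta(x)) >= n. Taking x = e_1 and then x = 1 gives m = n, and
   for q(x) = 1 all the x e_i have norm 1. So the 2n vectors of norm 1 are closed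
   under multiplication; they form a cyclic group on which theta is inversion.
   If an odd prime p divided 2n, 1 would be orthogonal to every other p-th root
   of unity, although these roots sum to 0. So 2n is a power of 2.

   Conversely, let z be a primitive 2N-th root of unity with N a power of 2, and
   let pi = 1 - z. Then pi^N and 2 divide each other in O, which shows that an
   integral combination of 1, pi, ..., pi^(N-1) lying in 2 O has even
   coefficients. This Eisenstein argument gives at once the independence of the
   powers of z and, as N O is contained in Z[z] by integrality of traces,
   O = Z[z]. *)

Require Import Defs.
From HB Require Import structures.
From mathcomp Require Import all_boot all_order all_algebra all_field.
From mathcomp Require Import cyclic ring.
From mathcomp Require Import boolp classical_sets.

Set Implicit Arguments.
Unset Strict Implicit.
Unset Printing Implicit Defensive.

Import Order.TTheory GRing.Theory Num.Theory passmx.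
Local Open Scope classical_set_scope.
Local Open Scope ring_scope.

(** * Lattices with an orthonormal basis *)

Lemma isometric_sym (L1 L2 : bilinear_module) : isometric L1 L2 -> isometric L2 L1.
Proof.
case=> f [g fK gK] fB.
pose g' : {additive L2 -> L1} :=
  HB.pack g (GRing.isZmodMorphism.Build L2 L1 g (can2_zmod_morphism fK gK)).
by exists g' => [|x y]; [exists f | rewrite -[in RHS](gK x) -[in RHS](gK y) fB].
Qed.

Lemma isometric_trans (L1 L2 L3 : bilinear_module) :
  isometric L1 L2 -> isometric L2 L3 -> isometric L1 L3.
Proof.
move=> [f bf fB] [g bg gB].
exists (g \o f : {additive L1 -> L3}) => [|x y /=]; first exact: bij_comp.
by rewrite gB fB.
Qed.

Lemma isometric_scale (c1 c2 c : rat) (L1 L2 : bilinear_module) :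
  isometric (scale c1 L1) (scale c2 L2) ->
  isometric (scale (c * c1) L1) (scale (c * c2) L2).
Proof.
move=> [f bf fB]; exists f => //= x y.
by rewrite -!mulrA; congr (_ * _); apply: fB.
Qed.

Lemma isometric_scale_id (c : rat) (L1 L2 : bilinear_module) :
  isometric L1 L2 -> isometric (scale c L1) (scale c L2).
Proof. by move=> [f bf fB]; exists f => //= x y; congr (_ * _); apply: fB. Qed.

Lemma isometric_form (L : bilinear_module) (b1 b2 : L -> L -> rat) : b1 =2 b2 ->
  isometric (BilinearModule b1) (BilinearModule b2).
Proof. by move=> eqb; exists (idfun : {additive L -> L}) => //=; exists id. Qed.

Fact A1_coord_proof (z : int) : \row_(i < 2) ((-1) ^+ i * z) \in A1_pred.
Proof. by rewrite inE big_ord_recl big_ord1 !mxE expr0 mul1r expr1 mulN1r subrr. Qed.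

(** The vectors of [A1] are the [(z, -z)], with products [2 z z'], so first coordinates turn its
    form into twice the standard one. This reduces (b) and (d) to (a) and (c). *)
Lemma A1_pow_isometric (n : nat) :
  isometric (pow_mod A1_mod n) (scale 2 (intlat_mod n)).
Proof.
pose f (x : {ffun 'I_n -> A1_type}) : 'rV[int]_n := \row_i A1_val (x i) 0 0.
pose g (y : 'rV[int]_n) := [ffun i => A1Type (A1_coord_proof (y 0 i))].
have A1_coord1 (x : A1_type) : A1_val x 0 1 = - A1_val x 0 0.
  apply/eqP; rewrite -addr_eq0 addrC; have := valP x.
  by rewrite inE big_ord_recl big_ord1 (_ : lift _ _ = 1) //; apply/val_inj.
have fB : zmod_morphism f by move=> x y; apply/rowP=> i; rewrite !(mxE, ffunE).
have fK : cancel f g.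
  move=> x; apply/ffunP=> i; rewrite ffunE; apply/val_inj/rowP=> /= j.
  rewrite !mxE; case: j => [[|[|//]]] /= lt_j.
    by rewrite expr0 mul1r; congr (_ 0 _); apply/val_inj.
  by rewrite expr1 mulN1r -A1_coord1; congr (_ 0 _); apply/val_inj.
have gK : cancel g f.
  by move=> y; apply/rowP=> i; rewrite mxE ffunE /= mxE expr0 mul1r.
pose f' : {additive pow_mod A1_mod n -> scale 2 (intlat_mod n)} :=
  HB.pack f (GRing.isZmodMorphism.Build _ _ f fB).
exists f' => [|x y /=]; first by exists g.
rewrite rmorph_sum mulr_sumr; apply: eq_bigr => i _ /=.
rewrite !mxE big_ord_recl big_ord1 (_ : lift _ _ = 1); last exact/val_inj.
by rewrite !A1_coord1 mulrNN rmorphD !rmorphM; apply: (mulr_natl _ 2).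
Qed.

(** * Bilinear calculus, sublattices and orthonormal bases *)

Section LatticeForm.
Variable L : lattice.
Implicit Types x y z : L.

Lemma bformDl x y z : bform (x + y) z = bform x z + bform y z.
Proof. exact: lattice_addl (latticeP L) x y z. Qed.

Lemma bformC x y : bform x y = bform y x.
Proof. exact: lattice_sym (latticeP L) x y. Qed.

Lemma bform0l y : bform 0 y = 0 :> rat.
Proof. by apply: (addrI (bform 0 y)); rewrite -bformDl !addr0. Qed.

Lemma bform_suml (I : Type) (r : seq I) (P : pred I) (F : I -> L) y :
  bform (\sum_(i <- r | P i) F i) y = \sum_(i <- r | P i) bform (F i) y.
Proof.
by elim/big_rec2: _ => [|i a x _ <-]; rewrite ?bform0l // bformDl.
Qed.

Lemma bformNl x y : bform (- x) y = - bform x y.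
Proof. by apply: (addrI (bform x y)); rewrite -bformDl !subrr bform0l. Qed.

Lemma bformMzl x y (k : int) : bform (x *~ k) y = k%:~R * bform x y.
Proof.
have bMn j : bform (x *+ j) y = j%:R * bform x y.
  by rewrite mulr_natl; elim: j => [|j IHj]; rewrite ?bform0l // !mulrS bformDl IHj.
case: k => k; first by rewrite -!pmulrn bMn.
by rewrite NegzE !mulrNz bformNl mulNr -!pmulrn bMn.
Qed.

Lemma bform_sumr (I : Type) (r : seq I) (P : pred I) (F : I -> L) x :
  bform x (\sum_(i <- r | P i) F i) = \sum_(i <- r | P i) bform x (F i).
Proof. by rewrite bformC bform_suml; apply: eq_bigr => i _; apply: bformC. Qed.

Lemma bformMzr x y (k : int) : bform x (y *~ k) = k%:~R * bform x y.
Proof. by rewrite bformC bformMzl bformC. Qed.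

Lemma sublattice_oppr (M : set L) x : is_sublattice M -> M x -> M (- x).
Proof. by case=> M0 MB Mx; rewrite -sub0r; apply: MB. Qed.

Lemma sublatticeD (M : set L) x y : is_sublattice M -> M x -> M y -> M (x + y).
Proof.
move=> lM Mx My; rewrite -[y]opprK.
by apply: lM.2 => //; apply: sublattice_oppr.
Qed.

Lemma sublatticeMz (M : set L) x k : is_sublattice M -> M x -> M (x *~ k).
Proof.
move=> lM Mx; have Mn j : M (x *+ j).
  by elim: j => [|j IHj]; [apply: lM.1 | rewrite mulrS; apply: sublatticeD].
by case: k => k; rewrite ?NegzE ?mulrNz -pmulrn; [|apply: sublattice_oppr].
Qed.

Lemma sublattice_sum (M : set L) (I : Type) (r : seq I) (P : pred I) (F : I -> L) :
  is_sublattice M -> (forall i, P i -> M (F i)) -> M (\sum_(i <- r | P i) F i).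
Proof.
move=> lM MF; elim/big_ind: _ => //; first exact: lM.1.
by move=> x y; apply: sublatticeD.
Qed.

(** Uniqueness of the coordinates follows: pairing with [e j] recovers the [j]-th one. *)
Definition orthonormal_basis (n : nat) (e : 'I_n -> L) : Prop :=
  (forall x, exists a : 'I_n -> int, x = \sum_i e i *~ a i) /\
  forall i j, bform (e i) (e j) = (i == j)%:R.

Section OrthonormalBasis.
Variables (n : nat) (e : 'I_n -> L) (eP : orthonormal_basis e).

Lemma bform_coord (a : 'I_n -> int) j : bform (\sum_i e i *~ a i) (e j) = (a j)%:~R.
Proof.
rewrite bform_suml (bigD1 j) //= bformMzl eP.2 eqxx mulr1 big1 ?addr0 // => i.
by move=> /negPf ne_ij; rewrite bformMzl eP.2 ne_ij mulr0.
Qed.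

Lemma bform_coords (a b : 'I_n -> int) :
  bform (\sum_i e i *~ a i) (\sum_i e i *~ b i) = (\sum_i a i * b i)%:~R.
Proof.
rewrite bform_sumr rmorph_sum; apply: eq_bigr => j _.
by rewrite bformMzr bform_coord mulrC rmorphM.
Qed.

Lemma orthonormal_eq x y : (forall j, bform x (e j) = bform y (e j)) -> x = y.
Proof.
have [a ->] := eP.1 x; have [b ->] := eP.1 y => eq_ab.
apply: eq_bigr => i _; congr (_ *~ _); apply: (@intr_inj rat).
by rewrite -!bform_coord.
Qed.

Lemma orthonormal_pos x : x != 0 -> 0 < bform x x.
Proof.
have [a -> nz] := eP.1 x; rewrite bform_coords ltr0z lt_def.
rewrite sumr_ge0 => [|i _]; last by rewrite -expr2 sqr_ge0.
rewrite andbT; apply: contraNneq nz => /eqP.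
rewrite psumr_eq0 => [/allP h|i _]; last by rewrite -expr2 sqr_ge0.
rewrite big1 // => i _; have := h i (mem_index_enum _).
by rewrite mulf_eq0 orbb => /eqP->.
Qed.

Lemma orthonormal_ge0 x : 0 <= bform x x.
Proof. by have [->|/orthonormal_pos/ltW//] := eqVneq x 0; rewrite bform0l. Qed.

Lemma orthonormal_ge1 x : x != 0 -> 1 <= bform x x.
Proof.
move=> /orthonormal_pos; have /intrP[k ->] := lattice_int (latticeP L) x x.
by rewrite ltr0z ler1z gtz0_ge1.
Qed.

(** The squares of the integer coordinates add up to 1, so one coordinate is 1 or -1 and all others
    vanish. *)
Lemma orthonormal_unit x : bform x x = 1 -> exists i, x = e i \/ x = - e i.
Proof.
move=> x1; have [a xE] := eP.1 x.
have [i nz_ai] : exists i, a i != 0.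
  apply/existsP; apply: contra_eqT x1 => /existsPn a0.
  suff -> : x = 0 by rewrite bform0l eq_sym oner_eq0.
  by rewrite xE big1 // => i _; have /negPn/eqP-> := a0 i.
exists i; have sqa j : 0 <= a j * a j by rewrite -expr2 sqr_ge0.
have suma : \sum_j a j * a j = 1.
  by apply: (@intr_inj rat); rewrite -bform_coords -xE.
have ai_ge1 : 1 <= a i * a i by rewrite -gtz0_ge1 lt_def sqa mulf_neq0.
have suma' : \sum_(j | j != i) a j * a j = 0.
  apply/eqP; rewrite eq_le sumr_ge0 // andbT.
  have := suma; rewrite (bigD1 i) //= => sumE.
  by rewrite -(lerD2l (a i * a i)) sumE addr0.
have a0 j : j != i -> a j = 0.
  move/eqP: suma'; rewrite psumr_eq0 // => /allP /(_ j (mem_index_enum _)) /implyP.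
  by move=> h /h; rewrite mulf_eq0 orbb => /eqP.
have : a i ^+ 2 == 1 by rewrite expr2 -suma [eqbRHS](bigD1 i) //= suma' addr0.
rewrite sqrf_eq1 => /orP ai; rewrite xE (bigD1 i) //= big1 ?addr0 => [|j /a0->//].
by case: ai => /eqP->; [left | right; rewrite mulrNz].
Qed.

Lemma orthonormal_root_lattice : root_lattice L.
Proof.
split=> [x|M lM Me]; first exact: orthonormal_pos.
apply/seteqP; split=> // x _; have [a ->] := eP.1 x.
apply: sublattice_sum => // i _; apply: sublatticeMz => //; apply: Me.
by left; rewrite eP.2 eqxx.
Qed.

(** * Indecomposable components of a lattice with an orthonormal basis *)

Definition int_line x : set L := [set y | exists k : int, y = x *~ k].

Lemma int_line_sublattice x : is_sublattice (int_line x).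
Proof.
split; first by exists 0.
by move=> _ _ [k ->] [l ->]; exists (k - l); rewrite mulrzBr.
Qed.

(** Nonzero vectors of two summands would be [k] and [l] times [e i], with product [k l], which is
    not 0. *)
Lemma int_line_indecomposable i : indecomposable (int_line (e i)).
Proof.
move=> [M [[subM orthM _] M0]].
have nzM j : exists2 x, M j x & x != 0.
  have [//|noM] := pselect (exists2 x, M j x & x != 0); case/eqP: (M0 j).
  apply/seteqP; split=> [x Mx | x ->]; last exact: (subM j).1.1.
  by apply: contrapT => /eqP x0; apply: noM; exists x.
have [[x Mx nzx] [y My nzy]] := (nzM ord0, nzM ord_max).
have := orthM ord0 ord_max isT x y Mx My.
move: nzx nzy; have [k ->] := (subM _).2 _ Mx; have [l ->] := (subM _).2 _ My.
move=> nzk nzl /eqP; rewrite bformMzl bformMzr eP.2 eqxx mulr1 mulf_eq0 !intr_eq0.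
by case/orP=> /eqP k0; [case/eqP: nzk | case/eqP: nzl]; rewrite k0 mulr0z.
Qed.

Lemma int_line_decomposition : indecomposable_decomposition (fun i => int_line (e i)).
Proof.
split; last first.
  move=> i; split; last exact: int_line_indecomposable.
  apply/eqP=> line0; have /= ei0 : [set 0] (e i) by rewrite -line0; exists 1.
  have /eqP := eP.2 i i; rewrite eqxx.
  by rewrite ei0 bform0l eq_sym oner_eq0.
split=> [i|i j ne_ij _ _ [k ->] [l ->]|x _].
- by split=> //; apply: int_line_sublattice.
- by rewrite bformMzl bformMzr eP.2 (negPf ne_ij) !mulr0.
have [a ->] := eP.1 x; exists [ffun i => e i *~ a i]; split.
  by split=> [i|]; [rewrite ffunE; exists (a i) | apply: eq_bigr => i _; rewrite ffunE].
move=> y [My sumy]; have /choice[b yE] := My.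
apply/ffunP=> i; rewrite ffunE yE; congr (_ *~ _); apply: (@intr_inj rat).
by rewrite -!bform_coord sumy; congr (bform _ _); apply: eq_bigr.
Qed.

(** The norms of the components of [e j] are nonnegative integers with sum 1, so a single component
    is nonzero. *)
Lemma orthonormal_in_summand (k : nat) (M : 'I_k -> set L) j :
  orthogonal_direct_sum [set: L] M -> exists i, M i (e j).
Proof.
move=> [subM orthM decM]; have [y [[My ejE] _]] := decM (e j) I.
have yy : \sum_i bform (y i) (y i) = 1.
  transitivity (bform (e j) (e j)); last by rewrite eP.2 eqxx.
  rewrite ejE bform_suml.
  apply: eq_bigr => i _; rewrite bform_sumr (bigD1 i) //= big1 ?addr0 // => l.
  by rewrite eq_sym => /orthM; apply.
have [i nzyi] : exists i, y i != 0.
  apply/existsP; apply: contra_eqT yy => /existsPn y0.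
  rewrite big1 => [|i _]; first by rewrite eq_sym oner_eq0.
  by have /negPn/eqP-> := y0 i; rewrite bform0l.
have yy' : \sum_(l | l != i) bform (y l) (y l) = 0.
  apply/eqP; rewrite eq_le sumr_ge0 ?andbT => [|l _]; last exact: orthonormal_ge0.
  have := yy; rewrite (bigD1 i) //= => sumE; rewrite -(lerD2l (bform (y i) (y i))) sumE.
  by rewrite addr0; apply: orthonormal_ge1.
exists i; rewrite ejE (bigD1 i) //= big1 ?addr0 // => l ne_li; apply/eqP.
apply: contraT => /orthonormal_pos; move/eqP: yy'.
rewrite psumr_eq0 => [/allP/(_ l (mem_index_enum _))|u _]; last exact: orthonormal_ge0.
by rewrite ne_li => /eqP->; rewrite ltxx.
Qed.

(** Uniqueness: each [e j] lies in some summand [M (t j)]. Indecomposability of the summands makes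
    [t] injective, and their being nonzero makes it surjective. *)
Lemma int_line_components : indecomposable_components (fun i => int_line (e i)).
Proof.
split=> [|k M [dsM indM]]; first exact: int_line_decomposition.
have /choice[t Mt] j := orthonormal_in_summand j dsM.
have [subM orthM decM] := dsM.
(* A vector of [M i] is orthogonal to every [e j] lying in another summand, so only the coordinates
   with [t j = i] survive. *)
have spanM i x : M i x -> exists a, x = \sum_(j | t j == i) e j *~ a j.
  move=> Mx; have [a xE] := eP.1 x; exists a; apply: orthonormal_eq => j.
  have [tj|ne_tj] := eqVneq (t j) i.
    rewrite {1}xE bform_coord bform_suml (bigD1 j) ?tj //= bformMzl eP.2 eqxx mulr1.
    rewrite big1 ?addr0 // => l /andP[_ /negPf ne_lj].
    by rewrite bformMzl eP.2 ne_lj mulr0.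
  rewrite (orthM i (t j)) 1?eq_sym // bform_suml big1 // => l /eqP tl.
  rewrite bformMzl eP.2 (_ : _ == _ = false) ?mulr0 //.
  by apply: contraNF ne_tj => /eqP<-; rewrite tl.
have t_inj : injective t.
  move=> j j' eq_t; apply/eqP; apply: contraT => ne_jj'.
  case: ((indM (t j)).2).
  (* A summand containing both [e j] and [e j'] would split into the line of [e j] (index [ord0])
     and the span of its other basis vectors. *)
  pose M' (u : 'I_2) x := exists a : 'I_n -> int,
    x = \sum_(l | (t l == t j) && ((l == j) == (u == ord0))) e l *~ a l.
  exists M'; split; last first.
    move=> u; pose l := if u == ord0 then j else j'.
    have M'l : M' u (e l).
      exists (fun i => (i == l)%:R); rewrite (bigD1 l) /=; last first.
        by rewrite /l; case: ifP; rewrite ?eqxx // eq_t eqxx [j' == j]eq_sym (negPf ne_jj').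
      by rewrite eqxx big1 ?addr0 // => i /andP[_ /negPf->].
    apply/eqP=> M'0; have /= el0 : [set 0] (e l) by rewrite -M'0.
    have /eqP := eP.2 l l; rewrite eqxx el0 bform0l eq_sym.
    by rewrite oner_eq0.
  split=> [u|u v ne_uv _ _ [a ->] [b ->]|x Mx].
  - split; last first.
      move=> _ [a ->]; apply: sublattice_sum => [|l /andP[/eqP <- _]].
        exact: (subM _).1.
      by apply: sublatticeMz; [apply: (subM _).1 | apply: Mt].
    split; first by exists (fun=> 0); rewrite big1.
    move=> _ _ [a ->] [b ->]; exists (fun l => a l - b l).
    by rewrite -sumrB; apply: eq_bigr => l _; rewrite mulrzBr.
  - rewrite bform_suml big1 // => i /andP[_ /eqP iu].
    rewrite bform_sumr big1 // => l /andP[_ /eqP lv].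
    rewrite bformMzl bformMzr eP.2; case: eqP => [eq_il|]; last by rewrite !mulr0.
    have : (u == ord0) == (v == ord0) by rewrite -iu -lv eq_il.
    by case: u v ne_uv {iu lv} => [[|[|//]] ?] [[|[|//]] ?].
  have [a xE] := spanM _ _ Mx.
  pose y (u : 'I_2) := \sum_(l | (t l == t j) && ((l == j) == (u == ord0))) e l *~ a l.
  have sumy : x = \sum_u y u.
    rewrite xE (bigID (fun l => l == j)) big_ord_recl big_ord1 /y /=.
    by congr (_ + _); apply: eq_bigl => l; case: (t l == _) (l == j) => [] [].
  exists [ffun u => y u]; split.
    split=> [u|]; first by rewrite ffunE; exists a.
    by rewrite sumy; apply: eq_bigr => u _; rewrite ffunE.
  move=> z [/choice[b zE] sumz]; apply/ffunP=> u; rewrite ffunE.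
  (* Pairing with [e l] sees only the part to which [l] belongs, so the sum determines both
     parts. *)
  have proj (w : 'I_2 -> L) (c : 'I_2 -> 'I_n -> int) l : (forall u, w u =
      \sum_(l | (t l == t j) && ((l == j) == (u == ord0))) e l *~ c u l) ->
      bform (w u) (e l) = if (t l == t j) && ((l == j) == (u == ord0)) then
        bform (\sum_u w u) (e l) else 0.
    move=> wE; case: ifP => [Pl|nPl]; last first.
      rewrite wE bform_suml big1 // => i Pi; rewrite bformMzl eP.2.
      by case: eqP => [eq_il|]; [rewrite eq_il nPl in Pi | rewrite mulr0].
    rewrite [in RHS](bigD1 u) //= bformDl bform_suml [X in _ + X]big1 ?addr0 // => v ne_vu.
    rewrite wE bform_suml big1 // => i /andP[_ /eqP Pi]; rewrite bformMzl eP.2.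
    case: eqP => [eq_il|]; last by rewrite mulr0.
    move: Pl; rewrite -eq_il => /andP[_ /eqP Pl].
    have : (u == ord0) == (v == ord0) by rewrite -Pl -Pi.
    by case: u v ne_vu {wE Pi Pl} => [[|[|//]] ?] [[|[|//]] ?].
  apply: orthonormal_eq => l.
  rewrite (proj y (fun=> a)) // (proj z b) //.
  by rewrite -sumy -sumz.
have t_surj i : exists j, t j = i.
  apply: contrapT => no_j; have [/eqP nzM _] := indM i; apply: nzM.
  apply/seteqP; split=> [x Mx|x ->]; last exact: (subM i).1.1.
  have [a ->] := spanM _ _ Mx; rewrite big1 // => j /eqP tj.
  by case: no_j; exists j.
have /choice[s sK] := t_surj.
exists s => [|i]; first by exists t => // j; apply: t_inj.
apply/seteqP; split=> [x Mx|_ [c ->]].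
  have [a ->] := spanM _ _ Mx; exists (a (s i)).
  rewrite (big_pred1 (s i)) // => j; apply/eqP/eqP=> [tj|->//].
  by apply: t_inj; rewrite sK.
by apply: sublatticeMz; [apply: (subM i).1 | rewrite -{1}(sK i); apply: Mt].
Qed.

End OrthonormalBasis.

Lemma isometric_intP (n : nat) :
  isometric L (int_lattice n) <-> exists e : 'I_n -> L, orthonormal_basis e.
Proof.
split=> [[f [g fK gK] fB]|[e eP]].
  exists (fun i => g (delta_mx 0 i)); split=> [x|i j]; last first.
    rewrite -fB !gK /= (bigD1 i) //= big1 ?addr0.
      by rewrite !mxE !eqxx mul1r; case: eqP.
    by move=> l /negPf ne_li; rewrite !mxE ne_li mul0r.
  exists (fun i => f x 0 i); apply: (can_inj fK); rewrite raddf_sum.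
  under eq_bigr do rewrite raddfMz gK.
  apply/rowP=> i; rewrite summxE (bigD1 i) //= big1 ?addr0.
    by rewrite -scaler_int !mxE !eqxx intz mulr1.
  by move=> l /negPf ne_li; rewrite -scaler_int !mxE eq_sym ne_li mulr0.
have /choice[a aE] := eP.1.
pose f (x : L) : 'rV[int]_n := \row_i a x i.
have aP x i : (a x i)%:~R = bform x (e i).
  by rewrite {2}(aE x) (bform_coord eP).
have fB : zmod_morphism f.
  move=> x y; apply/rowP=> i; rewrite !mxE; apply: (@intr_inj rat).
  by rewrite rmorphB /= !aP bformDl bformNl.
pose f' : {additive L -> int_lattice n} :=
  HB.pack f (GRing.isZmodMorphism.Build _ _ f fB).
exists f' => [|x y /=].
  exists (fun y : 'rV[int]_n => \sum_i e i *~ y 0 i) => [x|y].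
    by rewrite {2}(aE x); apply: eq_bigr => i _; rewrite mxE.
  apply/rowP=> i; rewrite mxE; apply: (@intr_inj rat).
  by rewrite aP (bform_coord eP).
rewrite {2}(aE x) {2}(aE y) (bform_coords eP).
by congr (_%:~R); apply: eq_bigr => i _; rewrite !mxE.
Qed.

End LatticeForm.

(** * Orthonormal bases of the trace form *)

Section FieldTrace.
Variable K : fieldExtType rat.

(** [field_trace] is defined in the basis [vbasis]; a change of basis conjugates the matrix of
    multiplication and keeps its trace. *)
Lemma field_trace_basis (n : nat) (e : n.-tuple K) (y : K) : basis_of {:K} e ->
  field_trace y = \sum_i coord e i (y * e`_i).
Proof.
move=> be; have dimK := size_basis be; subst n; pose b := vbasis {:K}.
have bb : basis_of {:K} b := vbasisP _.
have mxof11 : mxof b e \1%VF *m mxof e b \1%VF = 1%:M.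
  by rewrite -mxof_comp // comp_lfun1l mxof1 // (basis_free bb).
have -> : field_trace y = \tr (mxof e e (amulr y)).
  rewrite -[amulr y]comp_lfun1l -[amulr y]comp_lfun1r.
  by rewrite (mxof_comp _ _ bb) (mxof_comp _ _ bb) mxtrace_mulC mulmxA mxof11 mul1mx.
apply: eq_bigr => i _; rewrite !mxE /= vecof_delta lfunE /=.
by rewrite mulrC.
Qed.

Lemma rmorph_scale_rat (R : fieldType) (f : {rmorphism K -> R}) (c : rat) (x : K) :
  f (c *: x) = f c%:A * f x.
Proof. by rewrite -[c *: x]mulr_algl rmorphM. Qed.

Lemma integral_multiple (x : K) :
  exists (l : int) (y : ring_of_integers K), l != 0 /\ x = l%:~R^-1 *: val y.
Proof.
have [l nzl lx] := clear_denominator x; exists l, (RingOfIntegers lx); split=> //=.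
by rewrite -scaler_int scalerA mulVf ?scale1r // intr_eq0.
Qed.

End FieldTrace.

(** * Vectors of norm 1 of the trace form as roots of unity *)

Section OrthonormalTrace.
Variables (K : fieldExtType rat) (theta : {rmorphism K -> K}).
Variables (thetaK : forall x : K, theta (theta x) = x).
Variables (m : nat) (m_gt0 : (0 < m)%N) (trm : trace_ideal_generator K m).
Let n := \dim {:K}.
Let L := trace_div_lattice thetaK m_gt0 trm.
Variables (e : 'I_n -> ring_of_integers K) (eP : @orthonormal_basis L n e).
Implicit Types (x y : ring_of_integers K).
Let B x y : rat := @bform L x y.

Let BE x y : B x y = m%:R^-1 * field_trace (val x * theta (val y)).
Proof. by []. Qed.

Let nzm : (m%:R : rat) != 0. Proof. by rewrite pnatr_eq0 -lt0n. Qed.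

(** Every element of [K] is a rational multiple of an algebraic integer, so the [e i] span [K], and
    their number is the degree. *)
Lemma orthonormal_trace_basis : basis_of {:K} [tuple val (e i) | i < n].
Proof.
rewrite basisEdim size_tuple leqnn andbT; apply/subvP=> u _.
have [l [x [_ ->]]] := integral_multiple u; have [a ->] := eP.1 x.
rewrite memvZ // raddf_sum memv_suml // => i _; rewrite raddfMz -scaler_int memvZ //.
by apply: memv_span; apply/tnthP; exists i; rewrite tnth_mktuple.
Qed.

Lemma orthonormal_coord i (u : K) :
  coord [tuple val (e i) | i < n] i u = m%:R^-1 * field_trace (u * theta (val (e i))).
Proof.
rewrite {2}(coord_basis orthonormal_trace_basis (memvf u)) mulr_suml field_trace_sum.
rewrite mulr_sumr (bigD1 i) //= big1 ?addr0 => [|j ne_ji].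
  rewrite -scalerAl field_traceZ nth_mktuple mulrCA -BE.
  by rewrite [B _ _](eP.2 i i) eqxx mulr1.
rewrite -scalerAl field_traceZ nth_mktuple mulrCA -BE.
by rewrite [B _ _](eP.2 j i) (negPf ne_ji) mulr0.
Qed.

(** Multiplication by [theta x] is adjoint to multiplication by [x]. Hence the [i]-th diagonal entry
    of multiplication by [x * theta x] in the basis [e] is the norm of [x * e i]. *)
Lemma trace_norm_sum x : m%:R * B x x = \sum_i B (x * e i) (x * e i).
Proof.
rewrite BE mulVKf // (field_trace_basis _ orthonormal_trace_basis).
apply: eq_bigr => i _; rewrite orthonormal_coord nth_mktuple BE !rmorphM.
by congr (_ * field_trace _); rewrite /= -!mulrA; congr (_ * _); rewrite mulrCA.
Qed.

Let valN x : val (- x) = - val x.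
Proof. exact: raddfN. Qed.

Let val0 x : (val x == 0) = (x == 0).
Proof. by rewrite -(inj_eq val_inj) raddf0. Qed.

Lemma trace_norm_ge x : x != 0 -> n%:R <= m%:R * B x x.
Proof.
move=> nzx; rewrite trace_norm_sum -[in leLHS](card_ord n) -sumr_const ler_sum // => i _.
apply: (orthonormal_ge1 eP); rewrite -val0 rmorphM mulf_neq0 ?val0 //.
apply/eqP=> ei0; have /eqP := eP.2 i i; rewrite eqxx ei0.
by rewrite bform0l eq_sym oner_eq0.
Qed.

Let B11 : B 1 1 = n%:R / m%:R.
Proof. by rewrite BE rmorph1 mul1r rmorph1 field_trace1 mulrC. Qed.

Lemma orthonormal_degree : m = n.
Proof.
have nz1 : (1 : ring_of_integers K) != 0 by rewrite oner_eq0.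
(* The norm of 1 is [n / m], and it is at least 1, whence [m <= n]. *)
have := orthonormal_ge1 eP nz1; rewrite -[bform _ _]/(B 1 1) B11.
rewrite ler_pdivlMr ?ltr0n // mul1r ler_nat => le_mn.
have i : 'I_n by exists 0%N; apply: adim_gt0.
have nzei : e i != 0.
  apply/eqP=> ei0; have /eqP := eP.2 i i; rewrite eqxx ei0.
  by rewrite bform0l eq_sym oner_eq0.
have := trace_norm_ge nzei; rewrite [B _ _](eP.2 i i) eqxx mulr1 ler_nat => le_nm.
by apply/eqP; rewrite eqn_leq le_mn.
Qed.

Let B1 : B 1 1 = 1. Proof. by rewrite B11 -orthonormal_degree divff. Qed.

Let unitE x : B x x = 1 -> exists i, x = e i \/ x = - e i.
Proof. exact: (orthonormal_unit eP). Qed.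

Let Bee i : B (e i) (e i) = 1. Proof. by rewrite [LHS](eP.2 i i) eqxx. Qed.

Let BNl x y : B (- x) y = - B x y.
Proof. exact: (bformNl (L:=L)). Qed.

Let BNr x y : B x (- y) = - B x y.
Proof.
have BC u v : B u v = B v u by apply: (bformC (L:=L)).
by rewrite BC BNl BC.
Qed.

Let BN x : B (- x) (- x) = B x x.
Proof. by rewrite BNl BNr opprK. Qed.

(** Equality case of [trace_norm_ge]: the terms [B (x * e j) (x * e j) - 1] are nonnegative and add
    up to [m - n = 0], while [y] is some [e i] up to sign. *)
Lemma norm1_mul x y : B x x = 1 -> B y y = 1 -> B (x * y) (x * y) = 1.
Proof.
move=> x1 /unitE[i yE]; suff : B (x * e i) (x * e i) = 1.
  by case: yE => ->; rewrite ?mulrN ?BN.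
have nzx : x != 0.
  apply: contra_eq_neq x1 => ->.
  by rewrite [B 0 0](bform0l (L:=L)) eq_sym oner_eq0.
have ge1 j : 0 <= B (x * e j) (x * e j) - 1.
  rewrite subr_ge0; apply: (orthonormal_ge1 eP); rewrite -val0 rmorphM mulf_neq0 ?val0 //.
  by apply: contra_eq_neq (Bee j) => ->; rewrite [B 0 0](bform0l (L:=L)) eq_sym oner_eq0.
have : \sum_j (B (x * e j) (x * e j) - 1) == 0.
  by rewrite sumrB -trace_norm_sum x1 mulr1 sumr_const card_ord orthonormal_degree subrr.
rewrite psumr_eq0 // => /allP/(_ i (mem_index_enum _)).
by rewrite subr_eq0 => /eqP.
Qed.

Lemma norm1_exp x k : B x x = 1 -> B (x ^+ k) (x ^+ k) = 1.
Proof.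
move=> x1; elim: k => [|k IHk]; first by rewrite expr0 B1.
by rewrite exprS norm1_mul.
Qed.

(** Both [x] and 1 are basis vectors up to sign, and the two exclusions force different indices. *)
Lemma norm1_orthogonal x : B x x = 1 -> x != 1 -> x != -1 -> B x 1 = 0.
Proof.
move=> /unitE[i xE]; have [j E1] := unitE B1.
have [eq_ij|ne_ij] := eqVneq i j.
  by rewrite -eq_ij in E1; case: xE E1 => -> [] ->; rewrite ?opprK ?eqxx.
have eij : B (e i) (e j) = 0 by rewrite [LHS](eP.2 i j) (negPf ne_ij).
by move=> _ _; case: xE E1 => -> [] ->; rewrite ?BNr ?BNl eij ?oppr0.
Qed.

(** The product [x * theta x] has norm 1 and its pairing with 1 is [B x x = 1]. Among the vectors of
    norm 1 only 1 does that: -1 gives -1, and the others are orthogonal to 1. *)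
Lemma norm1_theta x : B x x = 1 -> val x * theta (val x) = 1.
Proof.
move=> x1; pose x' := RingOfIntegers (integral_theta theta (valP x)).
have x'1 : B x' x' = 1 by rewrite -x1 !BE /= thetaK [theta _ * _]mulrC.
suff /(congr1 val) : x * x' = 1 by rewrite rmorphM rmorph1.
have z1 : B (x * x') 1 = 1.
  by rewrite -x1 !BE rmorph1 mulr1 rmorphM.
apply/eqP; apply: contra_eqT z1 => nz1; rewrite eq_sym.
have [->|nzN1] := eqVneq (x * x') (- 1).
  rewrite [B _ _](bformNl (L:=L)) [bform _ _]B1 -subr_eq0 opprK.
  by rewrite -mulr2n pnatr_eq0.
by rewrite norm1_orthogonal ?oner_eq0 //; apply: norm1_mul.
Qed.

Let units := [seq val (e i) | i : 'I_n] ++ [seq - val (e i) | i : 'I_n].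

Let mem_units u : (u \in units) <-> exists2 x, B x x = 1 & val x = u.
Proof.
rewrite mem_cat; split=> [/orP[]/mapP[i _ ->]|[x /unitE[i ex] <-]].
- by exists (e i).
- by exists (- e i); rewrite ?BN ?rmorphN.
apply/orP; case: ex => ->; [left|right]; apply/mapP; exists i;
by rewrite ?mem_enum ?rmorphN.
Qed.

Let size_units : size units = n.*2.
Proof. by rewrite size_cat !size_map -enumT size_enum_ord addnn. Qed.

Let uniq_units : uniq units.
Proof.
have einj i j : e i = e j -> i = j.
  move=> eij; have := eP.2 i j; rewrite eij [LHS]Bee.
  by case: eqP => // _ /eqP; rewrite oner_eq0.
have eN i j : e i <> - e j.
  move=> eij; have := eP.2 i j; rewrite eij (bformNl (L:=L)) [bform _ _]Bee => /eqP.
  by case: (i == j); rewrite ?oppr_eq0 ?oner_eq0 // -subr_eq0 -opprD oppr_eq0 pnatr_eq0.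
rewrite cat_uniq !map_inj_uniq -?enumT ?enum_uniq ?andbT //=.
- apply/hasPn=> _ /mapP[i _ ->]; apply/mapP=> -[j _ /esym].
  by rewrite -valN => /val_inj/eN.
- by move=> i j /oppr_inj/val_inj/einj.
- by move=> i j /val_inj/einj.
Qed.

Lemma units_unity u : u \in units -> n.*2.-unity_root u.
Proof.
move=> u_in; have /mem_units[x x1 xu] := u_in.
have u0 : u != 0.
  rewrite -xu val0; apply: contra_eq_neq x1 => ->.
  by rewrite [B 0 0](bform0l (L:=L)) eq_sym oner_eq0.
(* Multiplication by u permutes the units, so it preserves their product. *)
pose uu := [seq u * v | v <- units].
have uu_uniq : uniq uu by rewrite map_inj_uniq //; apply: mulfI.
have sub_uu : {subset uu <= units}.
  move=> _ /mapP[v /mem_units[y y1 <-] ->]; apply/mem_units.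
  by exists (x * y); [apply: norm1_mul | rewrite rmorphM /= xu].
have perm_uu : perm_eq uu units.
  apply: uniq_perm => //.
  by case: (uniq_min_size uu_uniq sub_uu); rewrite ?size_map.
have := perm_big units (P := xpredT) (F := id) (op := *%R) (x := 1) perm_uu.
rewrite big_map big_split /= big_const_seq count_predT size_units iter_mulr mulr1.
move=> /eqP; rewrite -[eqbRHS]mul1r => /eqP/mulIf h; apply/unity_rootP/h.
rewrite prodf_seq_neq0; apply/allP=> v /mem_units[y y1 <-] /=.
rewrite val0; apply: contra_eq_neq y1 => ->.
by rewrite [B 0 0](bform0l (L:=L)) eq_sym oner_eq0.
Qed.

(** The [2 n] vectors of norm 1 are distinct roots of [X^(2n) - 1] in a field, hence all its roots,
    and the group that they form is cyclic. *)
Lemma orthonormal_prim_root : exists2 z, B z z = 1 & n.*2.-primitive_root (val z).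
Proof.
have: has n.*2.-primitive_root units.
  apply: has_prim_root => //; last by rewrite size_units.
  - by rewrite double_gt0 adim_gt0.
  - by apply/allP=> u; apply: units_unity.
by case/hasP=> _ /mem_units[z z1 <-]; exists z.
Qed.

Lemma orthonormal_two_power : exists2 a, (0 < a)%N & n.*2 = (2 ^ a)%N.
Proof.
have [z z1 prim_z] := orthonormal_prim_root.
have n2_gt0 : (0 < n.*2)%N by rewrite double_gt0 adim_gt0.
suff /p_natP[[|a] na] : (2%N).-nat n.*2.
- by have := odd_double n; rewrite na.
- by exists a.+1.
apply/pnatP=> // p p_pr p_dv; rewrite inE; apply: contraT => p_neq2.
have odd_p : odd p by case: (even_prime p_pr) p_neq2 => [->|].
have prim_w := dvdn_prim_root prim_z p_dv.
pose w : ring_of_integers K := z ^+ (n.*2 %/ p).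
have wE k : val (w ^+ k) = (val z ^+ (n.*2 %/ p)) ^+ k by rewrite !rmorphXn.
have sum_w : \sum_(k < p) w ^+ k = 0.
  apply/eqP; rewrite -val0.
  have -> : val (\sum_(k < p) w ^+ k) = \sum_(k < p) (val z ^+ (n.*2 %/ p)) ^+ k.
    by rewrite raddf_sum; apply: eq_bigr => k _; apply: wE.
  have := subrX1 (val z ^+ (n.*2 %/ p)) p; rewrite prim_expr_order // subrr => /esym/eqP.
  rewrite mulf_eq0 => /orP[|//].
  rewrite subr_eq0 -[X in X == _]expr1 -(prim_order_dvd prim_w).
  by rewrite dvdn1 => /eqP p1; rewrite p1 in p_pr.
(* Pairing the vanishing sum with 1 leaves only the term [k = 0], which is 1. *)
have : B (\sum_(k < p) w ^+ k) 1 = 0 by rewrite sum_w; apply: (bform0l (L:=L)).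
rewrite [B _ _](bform_suml (L:=L)); have p_gt0 := prime_gt0 p_pr.
rewrite (bigD1 (Ordinal p_gt0)) //= [X in X + _]B1 big1 ?addr0 => [/eqP|k nzk].
  by rewrite oner_eq0.
apply: norm1_orthogonal; first by do 2!apply: norm1_exp.
- apply: contraNneq nzk => /(congr1 val)/eqP; rewrite wE rmorph1 -(prim_order_dvd prim_w).
  by rewrite /dvdn modn_small // => /eqP k0; apply/eqP/val_inj.
(* Since [p] is odd and the characteristic is 0, -1 is not a [p]-th root of unity. *)
apply/eqP=> /(congr1 val); rewrite wE valN rmorph1 => wkN1.
have : ((val z ^+ (n.*2 %/ p)) ^+ k) ^+ p = 1.
  by rewrite exprAC (prim_expr_order prim_w) expr1n.
rewrite wkN1 -signr_odd odd_p expr1 => /eqP.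
by rewrite eq_sym -subr_eq0 opprK -mulr2n -(rmorph_nat (in_alg K)) fmorph_eq0 pnatr_eq0.
Qed.

Lemma orthonormal_two_power_cyclotomic : exists a, two_power_cyclotomic theta a.
Proof.
have [z z1 prim_z] := orthonormal_prim_root.
have [a a_gt0 na] := orthonormal_two_power.
have e_unity i : val (e i) ^+ n.*2 = 1.
  by apply/unity_rootP/units_unity/mem_units; exists (e i).
exists a; split=> // [|_ sigma x|a1 x].
- exists (val z); rewrite -?na //; apply/eqP.
  rewrite eqEsubv subvf -(span_basis orthonormal_trace_basis).
  apply/span_subvP=> _ /tnthP[i ->]; rewrite tnth_mktuple.
  have [k ->] := prim_rootP prim_z (e_unity i).
  by rewrite rpredX // memv_adjoin.
(* On the roots of unity [e i], both [theta] and complex conjugation are inversion; they then agree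
   on [K] by linearity over [rat]. *)
- have conj_rat c : (ratr c : algC)^* = ratr c.
    exact: (fmorph_eq_rat (Num.conj \o ratr)).
  have sc c u : sigma (c *: u) = ratr c * sigma u.
    rewrite rmorph_scale_rat; congr (_ * _).
    exact: (fmorph_eq_rat (sigma \o in_alg K)).
  rewrite {1 2}(coord_basis orthonormal_trace_basis (memvf x)) !rmorph_sum.
  apply: eq_bigr => i _; rewrite nth_mktuple theta_scalable !sc rmorphM.
  rewrite /= conj_rat; congr (_ * _).
  have -> : theta (val (e i)) = (val (e i))^-1.
    have ei1 := norm1_theta (Bee i); rewrite -[RHS]mulr1 -ei1 mulKf //.
    by apply: contra_eq_neq ei1 => ->; rewrite mul0r eq_sym oner_eq0.
  rewrite fmorphV invC_norm.
  have -> : `|sigma (val (e i))| = 1.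
    apply/eqP; rewrite -(@pexpr_eq1 _ _ n.*2) // ?double_gt0 ?adim_gt0 //.
    by rewrite -normrX -rmorphXn e_unity rmorph1 normr1.
  by rewrite expr1n invr1 mul1r.
(* For [a = 1], [2 n = 2] and [K] is the field of rationals. *)
have dim1 : \dim {:K} = 1%N.
  by apply: double_inj; rewrite -/n na a1.
have : x \in 1%VS.
  suff /eqP-> : (1%VS == {:K}%VS) by apply: memvf.
  by rewrite eqEdim subvf dim1 dimv1.
by case/vlineP=> c ->; rewrite theta_scalable rmorph1.
Qed.

End OrthonormalTrace.

(** * Powers of a root of unity of 2-power order *)

(** If [r] is a complex root of the minimal polynomial of [z], sending [p(z)] to [p(r)] is well
    defined. Having an embedding keeps [complex_conjugation] from being vacuous. *)
Lemma algC_embedding (K : fieldExtType rat) (z : K) :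
  <<1; z>>%VS = {:K}%VS -> inhabited {rmorphism K -> algC}.
Proof.
move=> gen_z; have /polyOver1P[q Dq] := minPolyOver 1 z.
have [r q_r] : exists r : algC, root (map_poly ratr q) r.
  apply/closed_rootP; rewrite size_map_poly -(size_map_poly (in_alg K)) -Dq.
  by rewrite size_minPoly eqSS.
pose ev (p : {poly rat}) : K := (map_poly (in_alg K) p).[z].
pose ev' (p : {poly rat}) : algC := (map_poly ratr p).[r].
have ev0 p : ev p = 0 -> ev' p = 0.
  move=> /rootP pz; have : minPoly 1 z %| map_poly (in_alg K) p.
    by apply: minPoly_dvdp => //; apply/polyOver1P; exists p.
  rewrite Dq dvdp_map => qp.
  by apply/rootP; apply: root_dvdp q_r; rewrite dvdp_map.
have /choice[P PE] (x : K) : exists p, x = ev p.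
  have /Fadjoin_polyP[_ /polyOver1P[p ->] ->] : x \in <<1; z>>%VS.
    by rewrite gen_z memvf.
  by exists p.
have evB p1 p2 : ev p1 = ev p2 -> ev' p1 = ev' p2.
  move=> eqp; apply/eqP; rewrite -subr_eq0 -hornerN -hornerD -!rmorphB /=.
  by apply/eqP/ev0; rewrite /ev rmorphB /= hornerD hornerN -/(ev p1) eqp subrr.
pose f x := ev' (P x).
have fB : zmod_morphism f.
  move=> x y; rewrite /f /ev' -hornerN -hornerD -rmorphB; apply: evB.
  by rewrite -PE /ev rmorphB /= hornerD hornerN -!/(ev _) -!PE.
have fM : monoid_morphism f.
  split=> [|x y]; last first.
    rewrite /f /ev' -hornerM -rmorphM; apply: evB.
    by rewrite -PE /ev rmorphM /= hornerM -!/(ev _) -!PE.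
  have <- : ev' 1 = 1 by rewrite /ev' rmorph1 hornerC.
  by apply: evB; rewrite -PE /ev rmorph1 hornerC.
constructor.
exact: (HB.pack f (GRing.isZmodMorphism.Build K algC f fB)
                  (GRing.isMonoidMorphism.Build K algC f fM)).
Qed.

(* The powers of 1/2 have traces of unbounded denominator. *)
Lemma half_notin_integral (K : fieldExtType rat) : (2^-1 : K) \notin integral_pred K.
Proof.
apply/negP=> half_int; pose n := \dim {:K}.
have n_gt0 : (0 < n)%N by apply: adim_gt0.
have /field_trace_int : (2^-1 : K) ^+ n \in integral_pred K by rewrite rpredX.
have -> : (2^-1 : K) ^+ n = (2^-1 ^+ n) *: 1.
  rewrite -[RHS]/(in_alg K _) rmorphXn fmorphV; congr (_^-1 ^+ _).
  by rewrite rmorph_nat.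
rewrite field_traceZ field_trace1 => /intrP[k kE].
have : n%:R = k%:~R * 2 ^+ n :> rat.
  by rewrite -kE mulrAC -exprMn mulVf ?expr1n ?mul1r // pnatr_eq0.
have k_gt0 : 0 < k by rewrite -(ltr0z rat) -kE mulr_gt0 ?exprn_gt0 ?invr_gt0 ?ltr0n.
move=> /eqP; apply/negP; rewrite lt_eqF //.
apply: (@lt_le_trans _ _ (2 ^+ n)); first by rewrite -natrX ltr_nat ltn_expl.
by rewrite ler_peMl ?exprn_ge0 // ler1z -gtz0_ge1.
Qed.

(** * Divisibility by [pi = 1 - z] and by powers of 2 *)

Section TwoPowerRoot.
Variables (K : fieldExtType rat) (k : nat) (z : K).
Let N := (2 ^ k)%N.
Hypothesis zN : z ^+ N = -1.
Let pi := 1 - z.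
Local Notation O := (integral_pred K).

Let N_gt0 : (0 < N)%N. Proof. by rewrite expn_gt0. Qed.

Let nz2 : (2 : K) != 0.
Proof. by rewrite -(rmorph_nat (in_alg K)) fmorph_eq0 pnatr_eq0. Qed.

Lemma root_integral : z \in O.
Proof.
apply/asboolP; exists ('X^N - (-1)%:P); first exact: monicXnsubC.
rewrite rmorphB /= map_polyXn map_polyC /= rootE hornerD hornerN hornerXn hornerC.
by rewrite zN mulrNz subrr.
Qed.

Let piO : pi \in O. Proof. by rewrite rpredB ?rpred1 ?root_integral. Qed.

(** With [t = z^(2^j)] and [M = 2^(k-j)], [t^M = -1], so [1 - t] divides [1 - t^(M+1) = 1 + t], and
    [(1 - t)^2] divides [1 - t^2]. For [j = k] the conclusion is that [pi^N] divides 2. *)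
Lemma one_sub_root_pow j : (j <= k)%N ->
  exists2 u, u \in O & pi ^+ (2 ^ j) * u = 1 - z ^+ (2 ^ j).
Proof.
elim: j => [|j IHj] lt_jk; first by exists 1; rewrite ?rpred1 ?mulr1.
have [u uO piu] := IHj (ltnW lt_jk); pose t := z ^+ (2 ^ j).
have tM : t ^+ (2 ^ (k - j)).+1 = - t.
  by rewrite exprSr -exprM -expnD subnKC ?(ltnW lt_jk) // zN mulN1r.
exists (u * u * \sum_(i < (2 ^ (k - j)).+1) t ^+ i).
  by rewrite !rpredM ?rpred_sum // => i _; rewrite !rpredX ?root_integral.
have := subrX1 t (2 ^ (k - j)).+1; rewrite tM -opprD => tE.
have {}tE : 1 + t = (1 - t) * \sum_(i < (2 ^ (k - j)).+1) t ^+ i.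
  by apply: oppr_inj; rewrite addrC tE -mulNr opprB.
rewrite expnS mul2n -addnn !exprD -/t -expr2.
have -> : 1 - t ^+ 2 = (1 - t) * (1 + t) by rewrite -subr_sqr expr1n.
by rewrite tE -piu mulrACA -!mulrA; congr (_ * _); rewrite mulrCA.
Qed.

(** Squaring is additive modulo 2. For [j = k] the term [1 + z^N] vanishes, so 2 divides [pi^N]. *)
Lemma one_sub_root_pow_mod2 j :
  exists2 w, w \in O & pi ^+ (2 ^ j) = 1 + z ^+ (2 ^ j) + 2 * w.
Proof.
elim: j => [|j [w wO piE]].
  exists (- z); first by rewrite rpredN root_integral.
  by rewrite !expr1 /pi mulrN mulr_natl mulr2n opprD addrA addrK.
pose t := z ^+ (2 ^ j); exists (t + 2 * w * (1 + t) + 2 * w ^+ 2).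
  by rewrite !(rpredD, rpredM, rpredX, rpred1, rpred_nat, root_integral).
by rewrite expnS mulnC !exprM piE -/t; ring.
Qed.

Lemma half_pi_pow : 2^-1 * pi ^+ N \in O.
Proof.
have [w wO ->] := one_sub_root_pow_mod2 k.
by rewrite zN subrr add0r mulKf.
Qed.

Lemma two_div_pi_pow : 2 / pi ^+ N \in O /\ pi != 0.
Proof.
have [u uO] := one_sub_root_pow (leqnn k); rewrite zN opprK -[1 + 1]/2 => piu.
have nzpi : pi != 0.
  by apply: contra_eq_neq piu => ->; rewrite expr0n gtn_eqF ?N_gt0 // mul0r eq_sym.
by split=> //; rewrite -piu mulrAC divff ?mul1r // expf_neq0.
Qed.

(** For [b] odd, [b^N = 2 q + 1], and subtracting [q] from its half would make 1/2 integral. *)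
Lemma even_of_half_pow (b : int) : 2^-1 * b%:~R ^+ N \in O -> (2 %| b)%Z.
Proof.
move=> bO; apply: contraT => odd_b; case/negP: (half_notin_integral K).
have : ~~ (2 %| b ^+ N)%Z.
  by move: odd_b; rewrite !dvdzE abszX Euclid_dvdX // N_gt0 andbT.
set c := b ^+ N => odd_c; have c1 : (c %% 2)%Z = 1.
  have := @ltz_pmod c 2 isT; have := @modz_ge0 c 2 isT.
  have : (c %% 2)%Z != 0 by apply: contraNneq odd_c => /dvdz_mod0P.
  by case: (c %% 2)%Z => // [[|[|]]].
have := divz_eq c 2; rewrite c1 => /(congr1 (fun d => d%:~R : K)).
rewrite rmorphXn rmorphD rmorphM /= => cE.
have -> : 2^-1 = 2^-1 * b%:~R ^+ N - (c %/ 2)%Z%:~R :> K.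
  by rewrite cE mulrDr mulr1 mulrCA mulVf // mulr1 addrAC subrr add0r.
by rewrite rpredB ?rpred_int.
Qed.

Lemma pi_coef_even (b : nat -> int) :
  2^-1 * (\sum_(i < N) (b i)%:~R * pi ^+ i) \in O -> forall i, (i < N)%N -> (2 %| b i)%Z.
Proof.
move=> bO; elim/ltn_ind => i IHi lt_iN.
have [pi2 nzpi] := two_div_pi_pow.
(* Multiplication by pi^(N-1-i) moves the terms of index > i into pi^N O = 2 O,
   and those of index < i are even by induction. *)
have biO : 2^-1 * (b i)%:~R * pi ^+ N.-1 \in O.
  have : 2^-1 * (\sum_(l < N) (b l)%:~R * pi ^+ l) * pi ^+ (N.-1 - i) \in O.
    by rewrite rpredM // rpredX.
  rewrite (bigD1 (Ordinal lt_iN)) //= mulrDr mulrDl rpredDr.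
    by rewrite -!mulrA -exprD subnKC // -ltnS prednK.
  rewrite mulr_sumr mulr_suml rpred_sum // => l ne_li.
  have [lt_li|le_il] := ltnP l i.
    have /dvdzP[q ->] := IHi l lt_li (ltn_ord l).
    have -> : 2^-1 * ((q * 2)%:~R * pi ^+ l) = q%:~R * pi ^+ l.
      by rewrite rmorphM /= !mulrA [2^-1 * _]mulrC mulfVK.
    by rewrite !rpredM ?rpredX ?rpred_int.
  have lt_il : (i < l)%N.
    rewrite ltn_neqAle le_il andbT.
    by apply: contraNneq ne_li => eq_il; apply/eqP/val_inj.
  have -> : 2^-1 * ((b l)%:~R * pi ^+ l) * pi ^+ (N.-1 - i) =
      (b l)%:~R * pi ^+ (l - i.+1) * (2^-1 * pi ^+ N).
    have lE : (l + (N.-1 - i) = l - i.+1 + N)%N.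
      rewrite -{1}(subnK lt_il) -addnA addSn subnKC ?prednK //.
      by rewrite -ltnS prednK.
    by rewrite [RHS]mulrACA -exprD -lE exprD !mulrA [2^-1 * _]mulrC.
  by rewrite rpredM ?half_pi_pow // rpredM ?rpredX ?rpred_int.
(* Multiplying by [2 / pi^N] leaves [b i / pi], whose [N]-th power times [pi^N / 2] is half of
   [(b i)^N]. *)
have bpiO : (b i)%:~R / pi \in O.
  have -> : (b i)%:~R / pi = 2^-1 * (b i)%:~R * pi ^+ N.-1 * (2 / pi ^+ N).
    have -> : pi ^+ N = pi ^+ N.-1 * pi by rewrite -exprSr prednK.
    by field; rewrite nz2 nzpi expf_neq0.
  by rewrite rpredM.
apply: even_of_half_pow.
have -> : 2^-1 * (b i)%:~R ^+ N = ((b i)%:~R / pi) ^+ N * (2^-1 * pi ^+ N).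
  by rewrite exprMn exprVn mulrACA mulVf ?expf_neq0 // mulr1 mulrC.
by rewrite rpredM ?half_pi_pow ?rpredX.
Qed.

(** Each factor 1/2 forces all coefficients to be even; halve them and repeat. *)
Lemma pi_coef_dvd j (b : nat -> int) :
  2^-1 ^+ j * (\sum_(i < N) (b i)%:~R * pi ^+ i) \in O ->
  forall i, (i < N)%N -> ((2 ^+ j : int) %| b i)%Z.
Proof.
elim: j b => [|j IHj] b bO i lt_iN; first by rewrite expr0 dvd1z.
have even_b l : (l < N)%N -> b l = 2 * (b l %/ 2)%Z.
  move=> lt_lN; rewrite mulrC divzK //; apply: (pi_coef_even (b := b)) lt_lN.
  have : 2 ^+ j * (2^-1 ^+ j.+1 * (\sum_(i < N) (b i)%:~R * pi ^+ i)) \in O.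
    by rewrite rpredM ?rpredX ?rpred_nat.
  by rewrite mulrA exprSr mulrA -exprMn divff // expr1n mul1r.
rewrite even_b // exprS dvdz_mul2l //.
apply: (IHj (fun l => (b l %/ 2)%Z)) lt_iN.
suff -> : \sum_(i < N) (b i %/ 2)%Z%:~R * pi ^+ i =
    2^-1 * \sum_(i < N) (b i)%:~R * pi ^+ i.
  by rewrite mulrA -exprSr.
rewrite mulr_sumr; apply: eq_bigr => l _.
by rewrite {2}(even_b _ (ltn_ord l)) rmorphM /= !mulrA mulVf // mul1r.
Qed.

(* The substitution X -> 1 - X turns polynomials in z into polynomials in pi. *)
Lemma root_poly_dvd j (p : {poly int}) : (size p <= N)%N ->
  2^-1 ^+ j * (map_poly intr p).[z] \in O -> exists r, p = (2 ^+ j) *: r.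
Proof.
move=> szp pO; pose s : {poly int} := 1%:P - 'X.
have sz_s : size s = 2 by rewrite /s -opprB size_polyN size_XsubC.
have ss : s \Po s = 'X.
  by rewrite {1}/s comp_polyB comp_polyX comp_polyC /s opprB addrCA subrr addr0.
pose q := p \Po s; have qp : q \Po s = p by rewrite -comp_polyA ss comp_polyXr.
have szq : (size q <= N)%N by rewrite size_comp_poly2.
have qpi : (map_poly intr p).[z] = \sum_(i < N) (q`_i)%:~R * pi ^+ i.
  rewrite -qp map_comp_poly horner_comp.
  have -> : (map_poly intr s).[z] = pi.
    by rewrite rmorphB /= map_polyX map_polyC hornerD hornerN hornerX hornerC.
  rewrite (@horner_coef_wide _ N) ?(leq_trans (size_poly _ _)) //.
  by apply: eq_bigr => i _; rewrite coef_map.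
rewrite qpi in pO; have q_dvd := pi_coef_dvd pO.
exists (\poly_(i < N) (q`_i %/ 2 ^+ j)%Z \Po s).
rewrite -comp_polyZ -{1}qp; congr (_ \Po s); apply/polyP=> i.
rewrite coefZ coef_poly; case: ltnP => [lt_iN|le_Ni].
  by rewrite mulrC divzK // q_dvd.
by rewrite mulr0 nth_default // (leq_trans szq).
Qed.

(** Zero is divisible by every power of 2 in [O], so once denominators are cleared the coefficients
    are too. *)
Lemma root_poly_eq0 (r : {poly rat}) : (size r <= N)%N ->
  (map_poly (in_alg K) r).[z] = 0 -> r = 0.
Proof.
have [q [a nza ->]] := rat_poly_scale r.
have nza' : (a%:~R^-1 : rat) != 0 by rewrite invr_eq0 intr_eq0.
rewrite size_scale // (size_map_inj_poly (@intr_inj rat)) // => szq.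
rewrite map_polyZ hornerZ => /eqP; rewrite mulf_eq0 fmorph_eq0 (negPf nza') /=.
move=> /eqP qz; suff -> : q = 0 by rewrite rmorph0 scaler0.
have {}qz : (map_poly intr q).[z] = 0.
  rewrite -[RHS]qz -map_poly_comp; congr (_.[z]).
  by apply: eq_map_poly => c /=; rewrite -[LHS](rmorph_int (in_alg K)).
apply/eqP; rewrite -lead_coef_eq0; set l := lead_coef q; apply: contraT => nzl.
(* The exponent [|l|] suffices for a contradiction, because [2^|l| > |l|]. *)
have [|s qE] := @root_poly_dvd `|l|%N q szq; first by rewrite qz mulr0 rpred0.
have : (2 ^+ `|l|%N %| l)%Z.
  by apply/dvdzP; exists (lead_coef s); rewrite mulrC -lead_coefZ -qE.
rewrite dvdzE abszX => /dvdn_leq; rewrite absz_gt0 nzl => /(_ isT).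
by rewrite leqNgt ltn_expl.
Qed.

Hypothesis gen_z : <<1; z>>%VS = {:K}%VS.

(** Independence is [root_poly_eq0], and the degree is at most [N] because [z] is a root of
    [X^N + 1]. Irreducibility of this polynomial is thus a consequence, not an input. *)
Lemma root_pow_basis : basis_of {:K} [tuple z ^+ i | i < N].
Proof.
rewrite basisEfree subvf size_tuple /=; apply/andP; split.
  apply/(freeP (X := [tuple z ^+ i | i < N]))=> c sum_c i; pose r := rVpoly (\row_i c i).
  have szr : (size r <= N)%N by rewrite /r /rVpoly size_poly.
  have r0 : r = 0.
    apply: root_poly_eq0 => //.
    rewrite (@horner_coef_wide _ N) ?(leq_trans (size_poly _ _)) //.
    rewrite -[RHS]sum_c; apply: eq_bigr => j _.
    by rewrite coef_map coef_rVpoly_ord mxE nth_mktuple /= mulr_algl.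
  by have := coef_rVpoly_ord (\row_i c i) i; rewrite -/r r0 coef0 mxE.
have mon : ('X^N - (-1)%:P : {poly K}) \is monic by apply: monicXnsubC.
rewrite -gen_z dim_Fadjoin dimv1 muln1 -ltnS -size_minPoly.
rewrite -(size_XnsubC (-1 : K) N_gt0); apply: dvdp_leq; first exact: monic_neq0.
apply: minPoly_dvdp; first by rewrite rpredB ?rpredX ?polyOverX // polyOverC rpredN mem1v.
by rewrite rootE hornerD hornerN hornerXn hornerC zN subrr.
Qed.

Lemma root_pow_dim : \dim {:K} = N.
Proof. exact: size_basis root_pow_basis. Qed.

(** Multiplication by [z^i] shifts the powers of [z] cyclically up to sign and fixes none of the
    exponents, so its matrix has zero diagonal. *)
Lemma field_trace_root_pow i : (0 < i < N)%N -> field_trace (z ^+ i) = 0.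
Proof.
case/andP=> i_gt0 lt_iN; rewrite (field_trace_basis _ root_pow_basis).
have free_b := basis_free root_pow_basis.
rewrite big1 // => j _; rewrite nth_mktuple -exprD.
have coordz l (lt_lN : (l < N)%N) :
    coord [tuple z ^+ i | i < N] j (z ^+ l) = (l == j)%:R.
  by rewrite -[z ^+ l](nth_mktuple (fun i : 'I_N => z ^+ i) 0 (Ordinal lt_lN)) coord_free.
have [lt_ijN|le_Nij] := ltnP (i + j) N.
  by rewrite coordz // -{2}[val j]add0n eqn_add2r (gtn_eqF i_gt0).
have -> : z ^+ (i + j) = - z ^+ (i + j - N).
  by rewrite -{1}(subnK le_Nij) exprD zN mulrN1.
rewrite linearN /= coordz; last by rewrite ltn_subLR // -addnS leq_add // ltnW.
rewrite (_ : _ == _ = false) ?oppr0 //; apply/negP=> /eqP ijN.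
have := subnK le_Nij; rewrite ijN addnC => /eqP; rewrite eqn_add2r => /eqP NE.
by rewrite NE ltnn in lt_iN.
Qed.

End TwoPowerRoot.

(** * The ring of integers and its trace form in the powers of [z] *)

Section TwoPowerTraceForm.
Variables (K : fieldExtType rat) (k : nat) (z : K).
Let N := (2 ^ k)%N.
Hypotheses (zN : z ^+ N = -1) (gen_z : <<1; z>>%VS = {:K}%VS).
Variable theta : {rmorphism K -> K}.
Hypotheses (thetaK : forall x : K, theta (theta x) = x) (theta_z : theta z = z^-1).

Let N_gt0 : (0 < N)%N. Proof. by rewrite expn_gt0. Qed.

(** As [theta] inverts [z], this is the trace of [z^(i-j)]; symmetry of the form allows [j <= i]. *)
Lemma trace_form_root_pow i j : (i < N)%N -> (j < N)%N ->
  trace_form theta (z ^+ i) (z ^+ j) = (i == j)%:R * N%:R.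
Proof.
wlog le_ji : i j / (j <= i)%N.
  move=> hw lt_iN lt_jN; case: (leqP j i) => [le_ji|/ltnW le_ij]; first exact: hw.
  rewrite /trace_form -(field_trace_theta thetaK) rmorphM thetaK mulrC.
  by rewrite -/(trace_form _ _ _) hw // eq_sym.
move=> lt_iN lt_jN.
have nz_zj : z ^+ j != 0.
  apply: expf_neq0; apply: contra_eq_neq zN => ->.
  by rewrite expr0n gtn_eqF // eq_sym oppr_eq0 oner_eq0.
rewrite /trace_form rmorphXn /= theta_z exprVn -{1}(subnK le_ji) exprD mulfK //.
move: le_ji; rewrite leq_eqVlt => /orP[/eqP->|lt_ji].
  by rewrite subnn expr0 field_trace1 (root_pow_dim zN gen_z) eqxx mul1r.
rewrite (field_trace_root_pow zN gen_z) ?subn_gt0 ?lt_ji ?(gtn_eqF lt_ji) ?mul0r //=.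
exact: leq_ltn_trans (leq_subr _ _) lt_iN.
Qed.

(** The powers of [z] are orthogonal of norm [N], so the coordinates of [N x] are its integral
    traces against them. As [N = 2^k], [root_poly_dvd] divides these coordinates by [N]. *)
Lemma integral_root_pow (x : ring_of_integers K) :
  exists b : 'I_N -> int, val x = \sum_(i < N) z ^+ i *~ b i.
Proof.
have basis_z := root_pow_basis zN gen_z.
have /choice[c cE] (i : 'I_N) : exists c : int, trace_form theta (val x) (z ^+ i) = c%:~R.
  have : trace_form theta (val x) (z ^+ i) \is a Num.int.
    apply: field_trace_int; rewrite rpredM ?(valP x) // integral_theta // rpredX //.
    exact: root_integral zN.
  by move/intrP.
(* [insub] only turns [i] into an ordinal; its default 0 is never reached for [i < N]. *)
pose P := \poly_(i < N) (if insub i is Some j then c j else 0).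
have Pz : (map_poly intr P).[z] = 2 ^+ k * val x.
  rewrite (@horner_coef_wide _ N) ?(leq_trans (size_poly _ _)) ?size_poly //.
  rewrite (coord_basis basis_z (memvf (val x))) mulr_sumr; apply: eq_bigr => i _.
  rewrite coef_map coef_poly ltn_ord valK nth_mktuple /=.
  suff cN : (c i)%:~R = 2 ^+ k * coord [tuple z ^+ i | i < N] i (val x).
    rewrite -[_ *: z ^+ i]mulr_algl mulrA; congr (_ * _).
    by rewrite -(rmorph_int (in_alg K)) cN rmorphM rmorphXn rmorph_nat.
  rewrite -cE {1}(coord_basis basis_z (memvf (val x))) /trace_form mulr_suml.
  rewrite field_trace_sum (bigD1 i) //= big1 ?addr0 => [|j ne_ji].
    rewrite -scalerAl field_traceZ nth_mktuple mulrC -/(trace_form _ _ _).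
    by rewrite trace_form_root_pow // eqxx mul1r natrX.
  rewrite -scalerAl field_traceZ nth_mktuple -/(trace_form _ _ _).
  by rewrite trace_form_root_pow // (negPf ne_ji : val j == val i = false) mul0r mulr0.
have nz2 : (2 : K) != 0 by rewrite -(rmorph_nat (in_alg K)) fmorph_eq0 pnatr_eq0.
have szP : (size P <= N)%N by apply: size_poly.
have [|r PE] := root_poly_dvd zN (j := k) szP.
  by rewrite Pz mulrA -exprMn mulVf // expr1n mul1r (valP x).
exists (fun i => r`_i).
have szr : (size r <= N)%N by rewrite -(size_scale r (a := 2 ^+ k)) ?expf_neq0 // -PE.
apply: (mulfI (expf_neq0 k nz2)); rewrite -Pz PE map_polyZ hornerZ rmorphXn; congr (_ * _).
rewrite (@horner_coef_wide _ N) ?(leq_trans (size_poly _ _)) //.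
by apply: eq_bigr => i _; rewrite coef_map /= mulrzl.
Qed.

Variables (m : nat) (m_gt0 : (0 < m)%N) (trm : trace_ideal_generator K m).

(** The trace of an algebraic integer is [N] times its coordinate at [z^0], and 1 has trace [N], so
    [m] and [N] divide each other. *)
Lemma trace_ideal_generator_root : m = N.
Proof.
have trz (x : ring_of_integers K) : exists b : int, field_trace (val x) = N%:R * b%:~R.
  have [b ->] := integral_root_pow x; exists (b (Ordinal N_gt0)).
  rewrite field_trace_sum (bigD1 (Ordinal N_gt0)) //= big1 ?addr0 => [|i nz_i].
    by rewrite -scaler_int field_traceZ field_trace1 (root_pow_dim zN gen_z) mulrC.
  rewrite -scaler_int field_traceZ (field_trace_root_pow zN gen_z) ?mulr0 //.
  by rewrite ltn_ord andbT lt0n; apply: contraNneq nz_i => i0; apply/eqP/val_inj.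
have [b mE] : exists b : int, m%:R = N%:R * b%:~R :> rat.
  have : [set m%:R * k%:~R | k in [set: int]] (m%:R : rat) by exists 1; rewrite ?mulr1.
  by rewrite -trm => -[x _ <-]; apply: trz.
have [b' NE] : exists b' : int, N%:R = m%:R * b'%:~R :> rat.
  have : [set field_trace (val x) | x in [set: ring_of_integers K]] (N%:R : rat).
    by exists 1 => //; rewrite rmorph1 field_trace1 (root_pow_dim zN gen_z).
  by rewrite trm => -[b' _ <-]; exists b'.
have {}mE : m%:Z = N%:Z * b by apply: (@intr_inj rat); rewrite rmorphM.
have {}NE : N%:Z = m%:Z * b' by apply: (@intr_inj rat); rewrite rmorphM.
apply/eqP; rewrite eqn_dvd.
have -> : (m %| N)%N by have : (m%:Z %| N%:Z)%Z by rewrite NE dvdz_mulr.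
by have : (N%:Z %| m%:Z)%Z by rewrite mE dvdz_mulr.
Qed.

Lemma root_pow_orthonormal (e : 'I_N -> ring_of_integers K) :
  (forall i : 'I_N, val (e i) = z ^+ i) ->
  @orthonormal_basis (trace_div_lattice thetaK m_gt0 trm) N e.
Proof.
move=> eE; split=> [x|i j].
  have [b xE] := integral_root_pow x; exists b; apply: val_inj.
  by rewrite xE raddf_sum; apply: eq_bigr => i _; rewrite raddfMz -eE.
rewrite /= !eE trace_form_root_pow // trace_ideal_generator_root mulrCA mulVf ?mulr1 //.
by rewrite pnatr_eq0 -lt0n.
Qed.

End TwoPowerTraceForm.

(** The generator [w] given by [cyclotomic_field] is a power of the arbitrary primitive root [z], so
    [z] generates too. If [a > 1], a complex embedding sends [z] to absolute value 1, where
    conjugation is inversion. *)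
Lemma two_power_cyclotomic_root (K : fieldExtType rat) (theta : {rmorphism K -> K})
    (a : nat) (z : K) :
  two_power_cyclotomic theta a -> (2 ^ a).-primitive_root z ->
  [/\ z ^+ (2 ^ (a - 1)) = -1, <<1; z>>%VS = {:K}%VS & theta z = z^-1].
Proof.
case=> a_gt0 [w prim_w gen_w] theta_conj theta_id prim_z.
have zN : z ^+ (2 ^ (a - 1)) = -1.
  have : (z ^+ (2 ^ (a - 1))) ^+ 2 == 1.
    have aE : (a - 1).+1 = a by rewrite subn1 prednK.
    by rewrite -exprM -expnSr aE prim_expr_order.
  have lt_a1 : (a - 1 < a)%N by rewrite subn1 ltn_predL.
  by rewrite sqrf_eq1 -(prim_order_dvd prim_z) gtnNdvd ?expn_gt0 ?ltn_exp2l // => /eqP.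
have gen_z : <<1; z>>%VS = {:K}%VS.
  apply/eqP; rewrite eqEsubv subvf -gen_w sub_adjoin1v.
  have [i ->] := prim_rootP prim_z (prim_expr_order prim_w).
  by rewrite rpredX // memv_adjoin.
split=> //; have [a_gt1|a_le1] := ltnP 1 a; last first.
  (* Here [z = -1] is its own inverse. *)
  have a1 : a = 1%N by apply/eqP; rewrite eqn_leq a_le1.
  by rewrite theta_id //; move: zN; rewrite a1 expr1 => ->; rewrite invrN1.
have [sigma] := algC_embedding gen_z.
apply: (fmorph_inj sigma); rewrite theta_conj // fmorphV invC_norm.
have -> : `|sigma z| = 1.
  apply/eqP; rewrite -(@pexpr_eq1 _ _ (2 ^ a)) ?expn_gt0 //.
  by rewrite -normrX -rmorphXn (prim_expr_order prim_z) rmorph1 normr1.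
by rewrite expr1n invr1 mul1r.
Qed.

(** * Similarity against isometry *)

Lemma isometric_scale_scale (c d : rat) (L : bilinear_module) :
  isometric (scale c (scale d L)) (scale (d * c) L).
Proof. by apply: isometric_form => x y; rewrite mulrA [d * c]mulrC. Qed.

Lemma isometric_scale_inj (c : rat) (L1 L2 : bilinear_module) : c != 0 ->
  isometric (scale c L1) (scale c L2) -> isometric L1 L2.
Proof. by move=> nzc [f bf fB]; exists f => // x y; apply: (mulfI nzc); apply: fB. Qed.

Section Similarity.
Variables (K : fieldExtType rat) (theta : {rmorphism K -> K}).
Variables (thetaK : forall x : K, theta (theta x) = x).
Variables (m : nat) (m_gt0 : (0 < m)%N) (trm : trace_ideal_generator K m).
Let n := \dim {:K}.

(** The trace form is [c = m2 / m1] times the standard form. Both [c] and [m] are positive and each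
    is an integer multiple of the other, so [c = m]. *)
Lemma similar_isometric :
  similar_lattices (trace_lattice thetaK) (int_lattice n) ->
  isometric (trace_div_lattice thetaK m_gt0 trm) (int_lattice n).
Proof.
move=> [m1 [m2 [nz1 nz2 [f [g fK gK] fB]]]].
have n_gt0 : (0 < n)%N by apply: adim_gt0.
pose c : rat := m2%:~R / m1%:~R.
have trE (x y : ring_of_integers K) :
    trace_form theta (val x) (val y) = c * (\sum_i f x 0 i * f y 0 i)%:~R.
  rewrite /c mulrAC; have /= -> := fB x y.
  by rewrite mulrAC divff ?mul1r // intr_eq0.
have tr1 (x : ring_of_integers K) : field_trace (val x) = trace_form theta (val x) 1.
  by rewrite /trace_form rmorph1 mulr1.
(* [m] is a trace, that is, the pairing of an algebraic integer with 1. *)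
have [j mE] : exists j : int, m%:R = c * j%:~R.
  have : [set m%:R * k%:~R | k in [set: int]] (m%:R : rat) by exists 1; rewrite ?mulr1.
  rewrite -trm => -[x _ <-]; rewrite tr1 -[1]/(val (1 : ring_of_integers K)) trE.
  by exists (\sum_i f x 0 i * f 1 0 i).
(* [c] is the norm of the preimage of a standard basis vector, hence the trace of an algebraic
   integer. *)
have [k cE] : exists k : int, c = m%:R * k%:~R.
  pose e := g (delta_mx 0 (Ordinal n_gt0)) : ring_of_integers K.
  have cE : c = trace_form theta (val e) (val e).
    rewrite trE gK (bigD1 (Ordinal n_gt0)) //= big1 ?addr0.
      by rewrite !mxE !eqxx mulr1.
    by move=> i /negPf ne_i; rewrite !mxE ne_i mulr0.
  have eO : val e * theta (val e) \in integral_pred K.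
    by rewrite rpredM ?integral_theta ?(valP e).
  have : [set field_trace (val x) | x in [set: ring_of_integers K]] c.
    by exists (RingOfIntegers eO).
  by rewrite trm => -[k _ <-]; exists k.
(* The sign of [c] is that of the norm of 1, which is the degree. *)
have c_gt0 : 0 < c.
  have := trE 1 1; rewrite rmorph1 -[1]/(val (1 : ring_of_integers K)) -tr1.
  rewrite rmorph1 field_trace1 => nE.
  have : 0 < c * (\sum_i f 1 0 i * f 1 0 i)%:~R by rewrite -nE ltr0n.
  rewrite pmulr_lgt0 // ltr0z lt_def sumr_ge0 ?andbT => [|i _]; last first.
    by rewrite -expr2 sqr_ge0.
  move: nE; case: eqP => // -> /eqP; by rewrite mulr0 pnatr_eq0 -leqn0 leqNgt n_gt0.
have k_gt0 : 0 < k by move: c_gt0; rewrite cE pmulr_rgt0 ?ltr0n // ltr0z.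
have j_gt0 : 0 < j.
  have : 0 < c * j%:~R by rewrite -mE ltr0n.
  by rewrite pmulr_rgt0 // ltr0z.
have cm : c = m%:R.
  rewrite cE; suff -> : k = 1 by rewrite mulr1.
  apply/eqP; rewrite eq_le -gtz0_ge1 k_gt0 andbT.
  have <- : k * j = 1.
    apply: (@intr_inj rat); apply: (@mulfI _ m%:R); first by rewrite pnatr_eq0 -lt0n.
    by rewrite rmorphM /= mulrA -cE -mE mulr1.
  by rewrite ler_peMr ?(ltW k_gt0) // -gtz0_ge1.
exists f => [|x y]; first by exists g.
by rewrite /= trE cm mulKf // pnatr_eq0 -lt0n.
Qed.

Lemma isometric_similar :
  isometric (trace_div_lattice thetaK m_gt0 trm) (int_lattice n) ->
  similar_lattices (trace_lattice thetaK) (int_lattice n).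
Proof.
move=> [f bf fB]; exists 1, m%:Z; split=> //; first by rewrite eqz_nat -lt0n.
exists f => // x y; have /= -> := fB x y.
by rewrite mulVKf ?mul1r // pnatr_eq0 -lt0n.
Qed.

Lemma two_power_cyclotomic_isometric (a : nat) : two_power_cyclotomic theta a ->
  isometric (trace_div_lattice thetaK m_gt0 trm) (int_lattice n).
Proof.
move=> cyc_a; have [_ [z prim_z _] _ _] := cyc_a.
have [zN gen_z theta_z] := two_power_cyclotomic_root cyc_a prim_z.
rewrite /n (root_pow_dim zN gen_z); apply/isometric_intP.
exists (fun i => RingOfIntegers (root_integral zN) ^+ i).
by apply: (root_pow_orthonormal zN gen_z thetaK theta_z) => i; rewrite rmorphXn.
Qed.

End Similarity.

Theorem theorem2 (K : fieldExtType rat) (n : nat) (dimK : \dim {:K} = n)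
    (theta : {rmorphism K -> K}) (thetaK : forall x : K, theta (theta x) = x)
    (m : nat) (m_gt0 : (0 < m)%N) (trm : trace_ideal_generator K m) :
  [/\ [<-> similar_lattices (trace_lattice thetaK) (int_lattice n);
            similar_lattices (trace_lattice thetaK) (lattice_pow A1 n);
            isometric (trace_div_lattice thetaK m_gt0 trm)
                      (int_lattice n);
            isometric (scale 2 (trace_div_lattice thetaK m_gt0 trm))
                      (lattice_pow A1 n);
            exists a : nat, two_power_cyclotomic theta a],
      forall a : nat, two_power_cyclotomic theta a ->
        n = (2 ^ (a - 1))%N /\ m = n
    & forall a : nat, two_power_cyclotomic theta a ->
        forall zeta : K, (2 ^ a)%N.-primitive_root zeta ->
        [/\ root_lattice (trace_div_lattice thetaK m_gt0 trm),
            @indecomposable_components (trace_div_lattice thetaK m_gt0 trm)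
              (2 ^ (a - 1)) (fun j => int_span (zeta ^+ j))
          & forall j : 'I_(2 ^ (a - 1)),
              trace_form theta (zeta ^+ j) (zeta ^+ j) / m%:R = 1]].
Proof.
subst n; split=> [|a cyc_a|a cyc_a zeta prim_zeta].
- have A1n := A1_pow_isometric (\dim {:K}); tfae.
  (* The power of [A1] carries twice the standard form; doubling [m1] compensates. *)
  + move=> [m1 [m2 [nz1 nz2 iso]]]; exists (2 * m1), m2; split=> //.
      by rewrite mulf_neq0.
    rewrite rmorphM; apply: isometric_trans (isometric_scale 2 iso) _.
    apply: isometric_trans (isometric_sym (isometric_scale_scale _ _ _)) _.
    exact/isometric_scale_id/isometric_sym.
  (* Now the factor 2 is absorbed by [m2], which leads back to (a) and so to (c). *)
  + move=> [m1 [m2 [nz1 nz2 iso]]]; apply: similar_isometric.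
    exists m1, (2 * m2); split=> //; first by rewrite mulf_neq0.
    apply: isometric_trans iso _; rewrite rmorphM.
    by apply: isometric_trans (isometric_scale_scale _ _ _); apply: isometric_scale_id.
  + move=> iso; apply: isometric_trans (isometric_sym A1n).
    exact: isometric_scale_id.
  + move=> iso; have /isometric_scale_inj : (2 : rat) != 0 by [].
    move=> /(_ _ _ (isometric_trans iso A1n))/isometric_intP[e eP].
    exact: orthonormal_two_power_cyclotomic eP.
  + case=> a cyc_a.
    exact: isometric_similar (two_power_cyclotomic_isometric thetaK m_gt0 trm cyc_a).
- have [_ [z prim_z _] _ _] := cyc_a.
  have [zN gen_z theta_z] := two_power_cyclotomic_root cyc_a prim_z.
  rewrite (root_pow_dim zN gen_z); split=> //.
  exact: (trace_ideal_generator_root zN gen_z thetaK theta_z trm).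
have [zN gen_z theta_z] := two_power_cyclotomic_root cyc_a prim_zeta.
pose e (i : 'I_(2 ^ (a - 1))) := RingOfIntegers (root_integral zN) ^+ i.
have eE i : val (e i) = zeta ^+ i by rewrite rmorphXn.
have eP := root_pow_orthonormal zN gen_z thetaK theta_z m_gt0 trm eE.
split=> [||j].
- exact: orthonormal_root_lattice eP.
(* [int_span] takes multiples in [K] and [int_line] in the lattice; they agree as [val] is additive
   and injective. *)
- have -> : (fun j : 'I_(2 ^ (a - 1)) => int_span (zeta ^+ j)) =
      (fun j => @int_line (trace_div_lattice thetaK m_gt0 trm) (e j)).
    apply: funext => j; have valMz k : val (e j *~ k) = zeta ^+ j *~ k.
      by rewrite -eE; apply: raddfMz.
    by apply/seteqP; split=> y [k yE]; exists k; [apply: val_inj|]; rewrite yE valMz.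
  exact: int_line_components.
by rewrite mulrC -eE; apply: etrans (eP.2 j j) _; rewrite eqxx.
Qed.
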